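(* Let $\mu:[0,\infty)\to[0,\infty)$ be a strictly increasing function with $\mu(0)=0$, smooth on $(0,\infty)$ with $\mu'>0$ there, let $\delta\in\mathbb{R}$, and let $$k(\rho):=\rho^{\delta}(\mu'(\rho))^2,\qquad \rho>0.$$ Then the Strong Coercivity Condition holds for $(\mu,k)$, that is, $$\mathcal{J}(\rho):=\int_{\mathbb{T}}\partial_{xx}^2\mu(\rho)\,\Big(\partial_x(k(\rho)\partial_x\rho)-\frac{k'(\rho)}{2}|\partial_x\rho|^2\Big)\,dx\ \ge 0\quad\text{for every positive }\rho\in H^2(\mathbb{T})\text{ bounded away from zero},$$ if and only if $-2\le\delta\le1$.
   Context: $\mathbb{T}$ is the one-dimensional flat torus. $H^2(\mathbb{T})$ is the usual Sobolev space. Here $\mu(\rho)$, $k(\rho)$, $\mu'(\rho)$, $k'(\rho)$ denote compositions with the function $\rho=\rho(x)$. *)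

(* Defs.v *)
From mathcomp Require Import all_boot all_order all_algebra.
From mathcomp Require Import all_classical all_reals all_analysis.

Set Implicit Arguments.
Unset Strict Implicit.
Unset Printing Implicit Defensive.

Import Order.TTheory GRing.Theory Num.Theory.
Import numFieldNormedType.Exports.

Local Open Scope classical_set_scope.
Local Open Scope ring_scope.

(* Functions on the torus T = R/Z are 1-periodic functions R -> R, integrated
   over the fundamental domain [0, 1].  Elements of Lebesgue and Sobolev spaces
   are handled through their representatives. *)

Definition smooth_on (R : realType) (D : set R) (f : R -> R) : Prop :=
  forall (n : nat) (x : R), D x -> derivable (derive1n n f) x 1.

Definition torus_integral (R : realType) (f : R -> R) : R :=
  Rintegral (@lebesgue_measure R) `[0, 1] f.

Definition torus_L1 (R : realType) (f : R -> R) : Prop :=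
  periodic f 1 /\ integrable (@lebesgue_measure R) `[0, 1] (EFin \o f).

Definition torus_L2 (R : realType) (f : R -> R) : Prop :=
  [/\ periodic f 1,
      measurable_fun (`[0, 1] : set R) f &
      integrable (@lebesgue_measure R) `[0, 1] (EFin \o (fun x => f x ^+ 2))].

Definition torus_test (R : realType) (phi : R -> R) : Prop :=
  periodic phi 1 /\ smooth_on setT phi.

Definition is_weak_deriv (R : realType) (f g : R -> R) : Prop :=
  [/\ torus_L1 f, torus_L1 g &
      forall phi : R -> R, torus_test phi ->
        torus_integral (fun x => f x * derive1 phi x) =
        - torus_integral (fun x => g x * phi x)].

(* A representative of the weak derivative on T, or 0 if there is none. *)
Definition weak_deriv (R : realType) (f : R -> R) : R -> R :=
  xget (cst 0 : R -> R) [set g | is_weak_deriv f g].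

Definition torus_H2 (R : realType) (f : R -> R) : Prop :=
  torus_L2 f /\
  exists f1 f2 : R -> R,
    [/\ torus_L2 f1, torus_L2 f2, is_weak_deriv f f1 & is_weak_deriv f1 f2].

Definition coercivity_functional (R : realType) (mu k rho : R -> R) : R :=
  let drho := weak_deriv rho in
  torus_integral (fun x =>
    weak_deriv (weak_deriv (fun y => mu (rho y))) x *
    (weak_deriv (fun y => k (rho y) * drho y) x
     - derive1 k (rho x) / 2 * `|drho x| ^+ 2)).

(* Every class in H^2(T) bounded below by c almost everywhere has a
   representative bounded below by c everywhere. *)
Definition strong_coercivity (R : realType) (mu k : R -> R) : Prop :=
  forall rho : R -> R, torus_H2 rho ->
    (exists2 c : R, 0 < c & forall x : R, c <= rho x) ->
    0 <= coercivity_functional mu k rho.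

(* Only its values at positive arguments are used. *)
Definition capillarity (R : realType) (delta : R) (mu : R -> R) (s : R) : R :=
  powR s delta * derive1 mu s ^+ 2.

(* Main.v *)
Require Import Defs.
From mathcomp Require Import all_boot all_order all_algebra.
From mathcomp Require Import ring lra.
From mathcomp Require Import all_classical all_reals all_analysis.
From mathcomp Require Import measurable_realfun.

Import Order.TTheory GRing.Theory Num.Theory.
Import numFieldNormedType.Exports.

Local Open Scope classical_set_scope.
Local Open Scope ring_scope.

Set Implicit Arguments.
Unset Strict Implicit.
Unset Printing Implicit Defensive.

(** Write v = mu(rho), a prime on rho or v for the derivative in x,
a = (1 - delta) / 3 and y = mu'(rho) rho'^2 / rho. Since k = rho^delta mu'^2, the
integrand of J(rho) is

  rho^delta mu'(rho) (v''^2 + (delta / 2) v'' y).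

The periodic function rho^(delta-1) v'^3 has the derivative
rho^delta mu'(rho) (3 v'' y + (delta - 1) y^2), whose integral over the torus is
therefore 0. Adding the multiple -(4 - delta) / 18 of it completes the square:

  J(rho) = int rho^delta mu'(rho) ((v'' - a y)^2 + kappa y^2),
  kappa = (1 - delta) (2 + delta) / 18.

This is [coercivity_functionalE], and it settles one direction: kappa >= 0 for
-2 <= delta <= 1.

Conversely, the square vanishes when v' rho^(-a) is constant. No periodic
nonconstant rho achieves this, but a wide oscillation comes close. Put
rho = exp(M sin theta) and let x be proportional to the integral of
mu'(rho) rho^(1-a) d theta over [0, theta]. Then v' rho^(-a) is a multiple of
cos theta, and because delta + 3 a = 1 all powers of rho and all derivatives of
mu cancel: up to a positive factor,

  J(rho) = int_0^(2 pi) (M^2 sin^2 theta + kappa M^4 cos^4 theta) d theta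
         = pi M^2 (1 + (3 / 4) kappa M^2),

which is negative for large M as soon as kappa < 0 ([exists_profile]).

The elements of H^2 are only representatives, and weak derivatives are chosen
arbitrarily in their class, so the computation needs a calculus of weak
derivatives. It rests on the fact that f has the weak derivative g exactly when f
coincides almost everywhere with an indefinite integral F of g such that
F 1 = F 0 ([is_weak_deriv_primitive], [primitive_is_weak_deriv]). The product rule
then reduces to integration by parts for indefinite integrals of integrable
functions ([primitiveM]), and the chain rule for rho in H^2 to the classical one,
since the continuous representative of rho is continuously differentiable
([is_weak_deriv_comp]). *)

Local Notation leb R := (@lebesgue_measure R).
Local Notation L1on a b f :=
  (integrable (@lebesgue_measure _) `[a, b] (EFin \o f)).
Local Notation int a b f := (Rintegral (@lebesgue_measure _) `[a, b] f).
Local Notation "f =ae g" :=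
  (ae_eq (@lebesgue_measure _) `[0, 1]%classic f g) (at level 70).

(** * Integration on segments, and primitives of integrable functions *)

Section integration_on_segments.
Context {R : realType}.
Implicit Types (f g : R -> R) (a b c x : R).

Lemma L1on_sub a b c x f : a <= c -> x <= b -> L1on a b f -> L1on c x f.
Proof.
move=> ac xb; apply: integrableS => //.
by apply: subset_itv; rewrite bnd_simp.
Qed.

Lemma L1onD a b f g : L1on a b f -> L1on a b g -> L1on a b (fun x => f x + g x).
Proof. by move=> hf hg; have := integrableD _ hf hg; apply; exact: measurable_itv. Qed.

Lemma L1onB a b f g : L1on a b f -> L1on a b g -> L1on a b (fun x => f x - g x).
Proof. by move=> hf hg; have := integrableB _ hf hg; apply; exact: measurable_itv. Qed.

Lemma L1onZ a b k f : L1on a b f -> L1on a b (fun x => k * f x).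
Proof. by move=> hf; have := integrableZl _ k hf; apply; exact: measurable_itv. Qed.

Lemma L1on_measurable a b f : L1on a b f -> measurable_fun `[a, b] f.
Proof. by case/integrableP => /measurable_EFinP. Qed.

Lemma L1on_le a b f g : measurable_fun `[a, b] f ->
  (forall x, x \in `[a, b] -> `|f x| <= `|g x|) -> L1on a b g -> L1on a b f.
Proof.
move=> mf fg; apply: le_integrable => //; exact/measurable_EFinP.
Qed.

Lemma within_continuous_bounded a b f : {within `[a, b], continuous f} ->
  exists M : R, forall x, x \in `[a, b] -> `|f x| <= M.
Proof.
move=> cf; have [ab|ba] := leP a b; last first.
  by exists 0 => x; rewrite in_itv/= => /andP[/le_trans h /h]; rewrite leNgt ba.
have cnf : {within `[a, b], continuous (fun x => `|f x|)}.
  by move=> x; apply: continuous_comp; [exact: cf|exact: norm_continuous].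
by have [c _ cM] := EVT_max ab cnf; exists `|f c| => x /cM.
Qed.

Lemma within_continuous_L1 a b f : {within `[a, b], continuous f} -> L1on a b f.
Proof. by apply: continuous_compact_integrable; exact: segment_compact. Qed.

Lemma L1on_mul_bounded a b f g : L1on a b f -> measurable_fun `[a, b] g ->
  (exists M : R, forall x, x \in `[a, b] -> `|g x| <= M) ->
  L1on a b (fun x => f x * g x).
Proof.
move=> hf mg [M gM]; apply: (@L1on_le _ _ _ (fun x => M * f x)).
- by apply: measurable_funM => //; exact: L1on_measurable.
- move=> x /gM h; rewrite !normrM mulrC ler_wpM2r//.
  exact: le_trans (ler_norm _).
- exact: L1onZ.
Qed.

Lemma L1on_mul_continuous a b f g : L1on a b f ->
  {within `[a, b], continuous g} -> L1on a b (fun x => f x * g x).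
Proof.
move=> hf cg; apply: L1on_mul_bounded => //; last exact: within_continuous_bounded.
exact: L1on_measurable (within_continuous_L1 cg).
Qed.

Lemma int_split a b c f : L1on a b f -> a <= c -> c <= b ->
  int a b f = int a c f + int c b f.
Proof.
move=> hf ac cb; apply/eqP; rewrite addrC -subr_eq; apply/eqP.
rewrite (Rintegral_itvB hf) ?bnd_simp//.
by rewrite Rintegral_itv_obnd_cbnd//; apply: integrableS hf => //;
   apply: subset_itv; rewrite bnd_simp.
Qed.

Lemma int_point a f : int a a f = 0.
Proof. by rewrite set_itv1 Rintegral_set1. Qed.

Lemma int_norm_sub a b c x f : L1on a b f -> a <= c -> x <= b ->
  int c x (fun t => `|f t|) <= int a b (fun t => `|f t|).
Proof.
move=> hf ac xb; have hn := integrable_norm hf.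
rewrite /Rintegral fine_le//.
- apply: integrable_fin_num => //.
  exact: (@L1on_sub a b c x (fun t => `|f t|)).
- exact: integrable_fin_num.
apply: ge0_subset_integral => //; first exact: measurable_int hn.
- by apply: subset_itv; rewrite bnd_simp.
Qed.

Lemma L1on_eq a b f g : (forall s, a <= s <= b -> f s = g s) ->
  L1on a b f -> L1on a b g.
Proof.
move=> fg; apply: eq_integrable => // s; rewrite inE/= in_itv/= => /fg.
by move=> ->.
Qed.

Lemma intD a b f g : L1on a b f -> L1on a b g ->
  int a b (fun s => f s + g s) = int a b f + int a b g.
Proof. exact: RintegralD. Qed.

Lemma intB a b f g : L1on a b f -> L1on a b g ->
  int a b (fun s => f s - g s) = int a b f - int a b g.
Proof. exact: RintegralB. Qed.

Lemma intZ a b k f : L1on a b f -> int a b (fun s => k * f s) = k * int a b f.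
Proof. exact: RintegralZl. Qed.

Lemma eq_int a b f g : (forall s, a <= s <= b -> f s = g s) ->
  int a b f = int a b g.
Proof. by move=> fg; apply: eq_Rintegral => s; rewrite inE/= in_itv/= => /fg. Qed.

End integration_on_segments.

Section primitives.
Context {R : realType}.
Implicit Types (f g F G : R -> R).

(** Absolute continuity of F on [0, 1], with its density f as a parameter. *)
Definition primitive F f :=
  L1on 0 1 f /\ forall x : R, 0 <= x <= 1 -> F x = F 0 + int 0 x f.

Lemma within_continuous_eq (a b : R) f g :
  (forall x, a <= x <= b -> f x = g x) ->
  {within `[a, b], continuous f} -> {within `[a, b], continuous g}.
Proof.
move=> fg; apply: subspace_eq_continuous => x.
by rewrite inE/= in_itv/= => /fg.
Qed.

Lemma within_continuousD (a b : R) f g : {within `[a, b], continuous f} ->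
  {within `[a, b], continuous g} -> {within `[a, b], continuous (fun x => f x + g x)}.
Proof. by move=> cf cg x; apply: cvgD; [exact: cf|exact: cg]. Qed.

Lemma within_continuousM (a b : R) f g : {within `[a, b], continuous f} ->
  {within `[a, b], continuous g} -> {within `[a, b], continuous (fun x => f x * g x)}.
Proof. by move=> cf cg x; apply: cvgM; [exact: cf|exact: cg]. Qed.

Lemma within_continuous_cst (a b k : R) : {within `[a, b], continuous (fun=> k : R)}.
Proof. by move=> x; exact: cvg_cst. Qed.

Lemma within_continuous_comp (a b : R) f g : {within `[a, b], continuous f} ->
  (forall x, a <= x <= b -> {for f x, continuous g}) ->
  {within `[a, b], continuous (fun x => g (f x))}.
Proof.
move=> /subspace_continuousP cf cg; apply/subspace_continuousP => x /=.
rewrite in_itv/= => xab; have xI : `[a, b]%classic x by rewrite /= in_itv.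
exact: (@cvg_comp _ _ _ f g _ _ _ (cf x xI) (cg x xab)).
Qed.

Lemma int_within_continuous a b f : a <= b -> L1on a b f ->
  {within `[a, b], continuous (fun x => int a x f)}.
Proof. exact: parameterized_integral_continuous. Qed.

Lemma primitive_continuous F f : primitive F f -> {within `[0, 1], continuous F}.
Proof.
move=> [hf FE].
apply: (@within_continuous_eq _ _ (fun x => F 0 + int 0 x f)) => [x /FE ->//|].
apply: within_continuousD; first exact: within_continuous_cst.
exact: int_within_continuous.
Qed.

Lemma primitive_int f : L1on 0 1 f -> primitive (fun x => int 0 x f) f.
Proof. by move=> hf; split => // x _; rewrite int_point add0r. Qed.

Lemma within_continuous_derivable_oo F a b : a < b ->
  {within `[a, b], continuous F} -> {in `]a, b[, forall x, derivable F x 1} ->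
  derivable_oo_LRcontinuous F a b.
Proof. by move=> ab /(continuous_within_itvP _ ab)[_ ? ?] dF; split. Qed.

Lemma within_continuous_itv_sub (a b c d : R) f : a <= c -> d <= b ->
  {within `[a, b], continuous f} -> {within `[c, d], continuous f}.
Proof.
move=> ac db; apply: continuous_subspaceW.
by apply: subset_itv; rewrite bnd_simp.
Qed.

(** Differentiability is only asked in the interior, where the integral of a density that
is continuous on the closed segment provides it. *)
Lemma int_derive (a b : R) F f : a <= b -> {within `[a, b], continuous f} ->
  {within `[a, b], continuous F} ->
  (forall x : R, a < x < b -> is_derive x 1 F (f x)) ->
  int a b f = F b - F a.
Proof.
rewrite le_eqVlt => /predU1P[-> _ _ _|ab cf cF dF].
  by rewrite int_point subrr.
have h := @continuous_FTC2 _ f F _ _ ab cf; rewrite /Rintegral h//.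
  apply: within_continuous_derivable_oo => // x.
  by rewrite in_itv/= => /dF[].
by move=> x; rewrite in_itv/= => /dF H; rewrite derive1E; exact: derive_val.
Qed.

Lemma int_cst (a b k : R) : a <= b -> int a b (cst k) = k * (b - a).
Proof.
move=> ab; rewrite mulrBr; apply: (@int_derive a b (fun x => k * x)) => //.
- exact: within_continuous_cst.
- by apply: continuous_subspaceT => x; apply: cvgM; [exact: cvg_cst|exact: cvg_id].
- move=> x _; rewrite -[cst k x]mulr1.
  exact: (@is_deriveZ _ _ _ id k x 1 1 (is_derive_id x 1)).
Qed.

Lemma primitive_C1 F f : {within `[0, 1], continuous f} ->
  {within `[0, 1], continuous F} ->
  (forall x : R, 0 < x < 1 -> is_derive x 1 F (f x)) -> primitive F f.
Proof.
move=> cf cF dF; split; first exact: within_continuous_L1.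
move=> x /andP[x0 x1]; suff -> : int 0 x f = F x - F 0 by rewrite addrC subrK.
apply: int_derive => //.
- exact: within_continuous_itv_sub cf.
- exact: within_continuous_itv_sub cF.
- by move=> y /andP[y0 yx]; apply: dF; rewrite y0 (lt_le_trans yx).
Qed.

End primitives.

(** * The product rule for primitives *)

Section product_rule.
Context {R : realType}.
Implicit Types (f g F G : R -> R) (x : R).

(** The difference of the two sides of the product rule, for the integrals of f and g
from 0, is bilinear in (f, g) and bounded by the product of the L^1 norms. It
vanishes when f and g are continuous, hence for all f and g by density of the
continuous functions in L^1, one argument at a time. *)
Let defect x f g := int 0 x f * int 0 x g -
  int 0 x (fun s => f s * int 0 s g + int 0 s f * g s).

Let L1_left x f g : 0 <= x -> L1on 0 x f -> L1on 0 x g ->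
  L1on 0 x (fun s => f s * int 0 s g).
Proof.
by move=> x0 hf hg; apply: L1on_mul_continuous => //; exact: int_within_continuous.
Qed.

Let L1_right x f g : 0 <= x -> L1on 0 x f -> L1on 0 x g ->
  L1on 0 x (fun s => int 0 s f * g s).
Proof.
by move=> x0 hf hg; apply: L1on_eq (L1_left x0 hg hf) => s _; rewrite mulrC.
Qed.

Let defectBl x f1 f2 g : 0 <= x -> L1on 0 x f1 -> L1on 0 x f2 -> L1on 0 x g ->
  defect x (fun s => f1 s - f2 s) g = defect x f1 g - defect x f2 g.
Proof.
move=> x0 h1 h2 hg; pose T (f : R -> R) s := f s * int 0 s g + int 0 s f * g s.
have hT f : L1on 0 x f -> L1on 0 x (T f).
  by move=> hf; apply: L1onD; [exact: L1_left|exact: L1_right].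
rewrite /defect.
have -> : int 0 x (fun s => (f1 s - f2 s) * int 0 s g
    + int 0 s (fun s => f1 s - f2 s) * g s) = int 0 x (T f1) - int 0 x (T f2).
  rewrite -intB; [|exact: hT|exact: hT].
  apply: eq_int => s /andP[s0 sx]; rewrite /T intB; first by ring.
  - exact: L1on_sub h1.
  - exact: L1on_sub h2.
by rewrite intB// /T; ring.
Qed.

Let defectC x f g : defect x f g = defect x g f.
Proof.
rewrite /defect mulrC; congr (_ - _); apply: eq_int => s _.
by rewrite addrC mulrC [X in _ + X]mulrC.
Qed.

Let nrm x f := int 0 x (fun s => `|f s|).

Let le_nrm x f : L1on 0 x f -> `|int 0 x f| <= nrm x f.
Proof. exact: le_normr_Rintegral. Qed.

Let nrm_ge0 x f : 0 <= nrm x f.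
Proof. by apply: Rintegral_ge0. Qed.

Let bound_left x f g : 0 <= x -> L1on 0 x f -> L1on 0 x g ->
  `|int 0 x (fun s => f s * int 0 s g)| <= nrm x f * nrm x g.
Proof.
move=> x0 hf hg; have hfg := L1_left x0 hf hg.
apply: le_trans (le_nrm hfg) _; rewrite mulrC -intZ; last exact: integrable_norm.
apply: le_Rintegral => //.
- exact: integrable_norm.
- by apply: L1onZ; exact: integrable_norm.
move=> s; rewrite /= in_itv/= => /andP[s0 sx].
rewrite normrM mulrC ler_wpM2r//.
apply: le_trans (le_nrm _) _; first exact: L1on_sub hg.
exact: int_norm_sub.
Qed.

Let defect_bound x f g : 0 <= x -> L1on 0 x f -> L1on 0 x g ->
  `|defect x f g| <= 3 * (nrm x f * nrm x g).
Proof.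
move=> x0 hf hg; rewrite /defect intD; last 2 first.
- exact: L1_left.
- exact: L1_right.
have b1 : `|int 0 x f * int 0 x g| <= nrm x f * nrm x g.
  by rewrite normrM ler_pM// le_nrm.
have b2 := bound_left x0 hf hg; have b3 := bound_left x0 hg hf.
rewrite [X in `|X|](_ : _ = int 0 x f * int 0 x g -
    int 0 x (fun s => f s * int 0 s g) - int 0 x (fun s => g s * int 0 s f)).
  have := ler_normB (int 0 x f * int 0 x g - int 0 x (fun s => f s * int 0 s g))
    (int 0 x (fun s => g s * int 0 s f)).
  have := ler_normB (int 0 x f * int 0 x g) (int 0 x (fun s => f s * int 0 s g)).
  lra.
rewrite opprD addrA; congr (_ - _); apply: eq_int => s _; exact: mulrC.
Qed.

Let continuous_L1 (a b : R) f : continuous f -> L1on a b f.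
Proof. by move=> cf; apply: within_continuous_L1; exact: continuous_subspaceT. Qed.

Lemma int_derivative (a x : R) f : a < x -> continuous f ->
  is_derive x 1 (fun y => int a y f) (f x).
Proof.
move=> ax cf.
have xx1 : x < x + 1 by rewrite ltrDl.
have [d e] := continuous_FTC1_closed xx1 (@continuous_L1 a (x + 1) f cf) ax (cf x).
by rewrite -e derive1E; split.
Qed.

Let defect_cont x f g : 0 <= x -> continuous f -> continuous g ->
  defect x f g = 0.
Proof.
move=> x0 cf cg; apply/eqP; rewrite subr_eq0; apply/eqP/esym.
have cF (h : R -> R) : continuous h -> {within `[0, x], continuous (fun s : R => int 0 s h)}.
  by move=> ch; apply: int_within_continuous => //; exact: continuous_L1.
have cW (h : R -> R) : continuous h -> {within `[0, x], continuous h}.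
  exact: continuous_subspaceT.
have -> : int 0 x f * int 0 x g = int 0 x f * int 0 x g - int 0 0 f * int 0 0 g.
  by rewrite int_point mul0r subr0.
apply: (@int_derive R 0 x (fun s => int 0 s f * int 0 s g)) => //.
- by apply: within_continuousD; apply: within_continuousM; auto.
- by apply: within_continuousM; auto.
move=> y /andP[y0 yx].
have d1 := int_derivative y0 cf; have d2 := int_derivative y0 cg.
by apply: is_derive_eq; rewrite /GRing.scale/= addrC mulrC [X in _ + X]mulrC.
Qed.

Let approx x f : L1on 0 x f -> forall e, 0 < e ->
  exists2 h, continuous h & nrm x (fun s => f s - h s) < e.
Proof.
move=> hf e e0.
have fin : (lebesgue_measure (`[0%R, x]%classic : set R) < +oo)%E.
  by apply: compact_finite_measure; exact: segment_compact.
have [h [ch ih /fine_cvgP[_ hcvg]]] :=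
  @approximation_continuous_integrable R _ f (measurable_itv `[0, x]) fin hf.
have /cvgrPdist_lt/(_ e e0)[N _ /(_ N (leqnn N))] := hcvg.
rewrite /= sub0r normrN => H; exists (h N) => //.
by apply: le_lt_trans (ler_norm _) _.
Qed.

Let defect0_half x f g : 0 <= x -> L1on 0 x f -> continuous g -> defect x f g = 0.
Proof.
move=> x0 hf cg; have hg := @continuous_L1 0 x g cg.
apply/eqP; rewrite -normr_le0; apply/ler_addgt0Pr => e e0; rewrite add0r.
have K0 : 0 < 3 * nrm x g + 1 by have := nrm_ge0 x g; lra.
have [h ch hh] := approx hf (divr_gt0 e0 K0).
have hhL := @continuous_L1 0 x h ch.
have := @defect_bound x (fun s => f s - h s) g x0 (L1onB hf hhL) hg.
rewrite defectBl// (defect_cont x0 ch cg) subr0 => /le_trans; apply.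
move: hh; rewrite ltr_pdivlMr//; have := nrm_ge0 x (fun s => f s - h s).
have := nrm_ge0 x g; nra.
Qed.

Let defect0 x f g : 0 <= x -> L1on 0 x f -> L1on 0 x g -> defect x f g = 0.
Proof.
move=> x0 hf hg; rewrite defectC.
apply/eqP; rewrite -normr_le0; apply/ler_addgt0Pr => e e0; rewrite add0r.
have K0 : 0 < 3 * nrm x f + 1 by have := nrm_ge0 x f; lra.
have [h ch hh] := approx hg (divr_gt0 e0 K0).
have hhL := @continuous_L1 0 x h ch.
have := @defect_bound x (fun s => g s - h s) f x0 (L1onB hg hhL) hf.
rewrite defectBl// (defectC _ h) (defect0_half x0 hf ch) subr0 => /le_trans; apply.
move: hh; rewrite ltr_pdivlMr//; have := nrm_ge0 x (fun s => g s - h s).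
have := nrm_ge0 x f; nra.
Qed.

Lemma primitiveM F f G g : primitive F f -> primitive G g ->
  primitive (fun x => F x * G x) (fun x => f x * G x + F x * g x).
Proof.
move=> pF pG; have cF := primitive_continuous pF; have cG := primitive_continuous pG.
case: pF pG => hf FE [hg GE].
split.
  apply: L1onD; first exact: L1on_mul_continuous.
  by apply: L1on_eq (L1on_mul_continuous hg cF) => s _; rewrite mulrC.
move=> x /[dup] x01 /andP[x0 x1].
have hfx := L1on_sub (lexx 0) x1 hf; have hgx := L1on_sub (lexx 0) x1 hg.
have := defect0 x0 hfx hgx; rewrite /defect => /eqP; rewrite subr_eq0 => /eqP E.
pose T s := f s * int 0 s g + int 0 s f * g s.
have hT : L1on 0 x T by apply: L1onD; [exact: L1_left|exact: L1_right].
have -> : int 0 x (fun s => f s * G s + F s * g s) =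
    int 0 x (fun s => (G 0 * f s + F 0 * g s) + T s).
  apply: eq_int => s /andP[s0 sx].
  have s01 : 0 <= s <= 1 by rewrite s0 (le_trans sx).
  by rewrite (FE s)// (GE s)// /T; ring.
rewrite intD//; last by apply: L1onD; apply: L1onZ.
rewrite /T -E intD ?intZ//; try exact: L1onZ.
by rewrite (FE x)// (GE x)//; ring.
Qed.

End product_rule.

(** * Smooth functions *)

Section smooth_functions.
Context {R : realType}.
Implicit Types f g : R -> R.

(** A recursion on the derivative rather than on the function: closure under products
is then a plain induction on n. *)
Fixpoint differentiable_upto (n : nat) f : Prop :=
  (forall x : R, derivable f x 1) /\
  if n is m.+1 then differentiable_upto m (derive1 f) else True.

Lemma differentiable_upto0 n f : differentiable_upto n f ->
  forall x : R, derivable f x 1.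
Proof. by case: n => [|n] []. Qed.

Lemma smooth_on_setT f : (forall n, differentiable_upto n f) -> smooth_on setT f.
Proof.
move=> sf n x _; elim: n f {sf}(sf n) => [|n IH] f; first by case.
by case=> _ /IH; rewrite derive1Sn.
Qed.

Lemma differentiable_uptoS n f f' : (forall x : R, is_derive x 1 f (f' x)) ->
  differentiable_upto n f' -> differentiable_upto n.+1 f.
Proof.
move=> df df'; split=> [x|]; first by case: (df x).
suff -> : derive1 f = f' by [].
by apply/funext => x; rewrite derive1E; exact: derive_val.
Qed.

Lemma differentiable_uptoW n f : differentiable_upto n.+1 f -> differentiable_upto n f.
Proof. by elim: n f => [|n IH] f [df /=]; [|move=> /IH]. Qed.

Lemma smooth_on_is_derive f : smooth_on setT f -> forall x : R, is_derive x 1 f (derive1 f x).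
Proof.
by move=> sf x; rewrite derive1E; apply/derivableP; exact: (sf 0%N).
Qed.

Lemma smooth_on_continuous f : smooth_on setT f -> continuous f.
Proof. by move=> sf x; apply: differentiable_continuous; apply/derivable1_diffP; exact: (sf 0%N). Qed.

Lemma smooth_on_derive1 f : smooth_on setT f -> smooth_on setT (derive1 f).
Proof. by move=> sf n x xT; rewrite -derive1Sn; exact: sf. Qed.

Lemma smooth_on_differentiable_upto f n : smooth_on setT f -> differentiable_upto n f.
Proof.
elim: n f => [|n IH] f sf; first by split=> // x; exact: (sf 0%N).
split=> [x|]; first exact: (sf 0%N).
by apply: IH; exact: smooth_on_derive1.
Qed.

Lemma smooth_on_primitive f f' : (forall x : R, is_derive x 1 f (f' x)) ->
  smooth_on setT f' -> smooth_on setT f.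
Proof.
move=> df sf' [|n] x xT; first by case: (df x).
rewrite derive1Sn (_ : derive1 f = f'); first exact: sf'.
by apply/funext => y; rewrite derive1E; exact: derive_val.
Qed.

Lemma differentiable_upto_cst n (k : R) : differentiable_upto n (cst k : R -> R).
Proof.
elim: n k => [|n IH] k //; apply: (@differentiable_uptoS _ _ (cst 0)) (IH 0).
Qed.

Lemma smooth_on_cst (k : R) : smooth_on setT (cst k : R -> R).
Proof. by apply: smooth_on_setT => n; exact: differentiable_upto_cst. Qed.

Lemma differentiable_uptoD n f g : differentiable_upto n f ->
  differentiable_upto n g -> differentiable_upto n (fun x => f x + g x).
Proof.
elim: n f g => [|n IH] f g [df hf] [dg hg].
  by split=> // x; apply: derivableD.
apply: (@differentiable_uptoS _ _ (fun x => derive1 f x + derive1 g x)); last exact: IH.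
move=> x; have /derivableP ? := df x; have /derivableP ? := dg x.
by rewrite !derive1E; exact: is_deriveD.
Qed.

Lemma differentiable_uptoM n f g : differentiable_upto n f ->
  differentiable_upto n g -> differentiable_upto n (fun x => f x * g x).
Proof.
elim: n f g => [|n IH] f g [df hf] [dg hg].
  by split=> // x; apply: derivableM.
have hf' : differentiable_upto n f by apply: differentiable_uptoW; split.
have hg' : differentiable_upto n g by apply: differentiable_uptoW; split.
apply: (@differentiable_uptoS _ _ (fun x => f x * derive1 g x + g x * derive1 f x)).
  move=> x; have /derivableP ? := df x; have /derivableP ? := dg x.
  by rewrite !derive1E; exact: is_deriveM.
by apply: differentiable_uptoD; exact: IH.
Qed.

Lemma differentiable_upto_sin n (a b : R) :
  differentiable_upto n (fun x => sin (a * x + b)).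
Proof.
have dsin (b' x : R) : is_derive x 1 (fun x => sin (a * x + b')) (a * sin (a * x + (b' + pi / 2))).
  rewrite addrA sinDpihalf.
  by apply: is_derive_eq; rewrite /GRing.scale/= ; ring.
elim: n b => [|n IH] b; first by split=> // x; exact: (@ex_derive _ _ _ _ _ _ _ (dsin b x)).
apply: differentiable_uptoS (dsin b) _.
by apply: differentiable_uptoM; [exact: differentiable_upto_cst|exact: IH].
Qed.

(** The logistic function solves y' = y (1 - y), so the derivative of its
composite with a smooth c is a polynomial in itself and c'. *)
Lemma differentiable_upto_logistic n (c : R -> R) : (forall m, differentiable_upto m c) ->
  differentiable_upto n (fun x => (1 + expR (c x))^-1).
Proof.
move=> sc; pose L x := (1 + expR (c x))^-1.
have dL (x : R) : is_derive x 1 L (- derive1 c x * (L x * (1 + - 1 * L x))).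
  have dc : is_derive x 1 c (derive1 c x).
    by rewrite derive1E; apply/derivableP; exact: (differentiable_upto0 (sc 0%N)).
  have p : 1 + expR (c x) != 0 by rewrite gt_eqF// addr_gt0// expR_gt0.
  have dE : is_derive x 1 (fun y => 1 + expR (c y)) (expR (c x) * derive1 c x).
    have dC := is_derive1_comp (is_derive_expR (c x)) dc.
    by have := is_deriveD (is_derive_cst (1 : R) x 1) dC; rewrite add0r.
  suff -> : - derive1 c x * (L x * (1 + - 1 * L x)) =
      - (1 + expR (c x)) ^- 2 *: (expR (c x) * derive1 c x) by exact: is_deriveV.
  by rewrite /GRing.scale/= /L; field.
elim: n => [|n IH]; first by split=> // x; exact: (@ex_derive _ _ _ _ _ _ _ (dL x)).
apply: differentiable_uptoS dL _.
have c' : differentiable_upto n (derive1 c) by case: (sc n.+1).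
apply: differentiable_uptoM.
  rewrite (_ : (fun x => - derive1 c x) = (fun x => cst (-1) x * derive1 c x)).
    by apply: differentiable_uptoM => //; exact: differentiable_upto_cst.
  by apply/funext => x /=; rewrite mulN1r.
apply: differentiable_uptoM => //; apply: differentiable_uptoD.
  exact: differentiable_upto_cst.
by apply: differentiable_uptoM => //; exact: differentiable_upto_cst.
Qed.

End smooth_functions.

(** * Functions orthogonal to the test functions vanish *)

Instance ae_leb_filter (R : realType) : Filter (nbhs (almost_everywhere (leb R))).
Proof. exact: ae_filter_ringOfSetsType. Qed.

Section vanishing_integrals.
Context {R : realType}.
Implicit Types f g : R -> R.

Lemma ae_neq (c : R) : {ae leb R, forall x, x != c}.
Proof.
exists [set c]; split => //; first exact: lebesgue_measure_set1.
by move=> x /= /negP; rewrite negbK => /eqP.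
Qed.

(** By the Lebesgue differentiation theorem, almost every value of g is the derivative
of its integral. *)
Lemma int_eq0_ae g : L1on 0 1 g ->
  (forall x : R, 0 < x < 1 -> int 0 x g = 0) ->
  g =ae cst 0.
Proof.
move=> hg g0; pose h := g \_ `[0, 1]%classic.
have hT : integrable (leb R) setT (EFin \o h).
  by rewrite -restrict_EFin; apply/(integrable_mkcond _ _).1 => //; exact: measurable_itv.
have hloc : locally_integrable setT h by apply: integrable_locally.
have hy (y : R) : integrable (leb R) [set` Interval (BLeft 0) (BRight y)] (EFin \o h).
  exact: integrableS hT.
have FTC := FTC1 hy hloc.
move: FTC (ae_neq 0) (ae_neq 1); apply: filterS3 => x FTC x0 x1.
rewrite /= in_itv/= => /andP[x0' x1'].
have {}x0 : 0 < x by rewrite lt_neqAle eq_sym x0.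
have {}x1 : x < 1 by rewrite lt_neqAle x1.
have [] := FTC; first by rewrite lte_fin.
move=> dF.
have -> : h x = g x by rewrite /h patchE mem_set//= in_itv/= x0' x1'.
move=> <-; rewrite derive1E.
rewrite (@near_eq_derive _ _ _ _ (cst 0)) ?derive_cst//.
near=> y.
have y0 : 0 < y by near: y; exact: lt_nbhsr.
have y1 : y < 1 by near: y; exact: lt_nbhsl.
transitivity (int 0 y g); last by rewrite g0// y0.
apply: eq_int => s /andP[s0 sy].
by rewrite /h patchE mem_set//= in_itv/= s0 (le_trans sy)// ltW.
Unshelve. all: by end_near. Qed.

(** The continuous periodic function y |-> sin(pi y) sin(pi (x - y)) is positive
on ]0, x[ and negative on ]x, 1[, so that the logistic functions of its large
multiples are test functions converging to the indicator of ]0, x[. *)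
Let bump x n (y : R) : R :=
  (1 + expR (- n%:R * (sin (pi * y) * sin (pi * (x - y)))))^-1.

Lemma torus_test_bump x n : torus_test (bump x n).
Proof.
split.
  move=> y; rewrite /bump mulrDr mulr1 sinDpi opprD addrA mulrBr mulr1.
  have -> : sin (pi * (x - y) - pi) = - sin (pi * (x - y)).
    by rewrite -[in RHS](subrK pi (pi * (x - y))) sinDpi opprK.
  by rewrite mulrNN.
apply: smooth_on_setT => m; apply: differentiable_upto_logistic => {}m.
apply: differentiable_uptoM; first exact: differentiable_upto_cst.
apply: differentiable_uptoM.
  rewrite (_ : (fun y => _) = (fun y => sin (pi * y + 0))).
    exact: differentiable_upto_sin.
  by apply/funext => y; rewrite addr0.
rewrite (_ : (fun y => _) = (fun y => sin (- pi * y + pi * x))).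
  exact: differentiable_upto_sin.
by apply/funext => y; congr sin; ring.
Qed.

Lemma bump_bound x n y : 0 <= bump x n y <= 1.
Proof.
have e0 := expR_gt0 (- n%:R * (sin (pi * y) * sin (pi * (x - y)))).
by rewrite /bump invr_ge0 invf_le1 ?lerDl; lra.
Qed.

Lemma logistic_cvg (c : R) : 0 < c ->
  (1 + expR (- n%:R * c))^-1 @[n --> \oo] --> (1 : R).
Proof.
move=> c0.
have E0 : expR (- n%:R * c) @[n --> \oo] --> (0 : R).
  rewrite (_ : (fun n => _) = (fun n => expR (- c) ^+ n)).
    by apply: cvg_expr; rewrite ger0_norm ?expR_ge0// expR_lt1 oppr_lt0.
  by apply/funext => n; rewrite -expRM_natl mulNr mulrN.
have E1 : 1 + expR (- n%:R * c) @[n --> \oo] --> (1 : R).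
  by rewrite -[X in _ --> X]addr0; apply: cvgD => //; exact: cvg_cst.
rewrite -[X in _ --> X]invr1; apply: cvgV E1; exact: oner_neq0.
Qed.

Lemma bump_cvg x y : 0 < x < 1 -> 0 < y < 1 -> y != x ->
  bump x n y @[n --> \oo] --> (if y < x then 1 else 0 : R).
Proof.
move=> /andP[x0 x1] /andP[y0 y1] yx.
have pi0 := pi_gt0 R.
have sy : 0 < sin (pi * y).
  by apply: sin_gt0_pi; rewrite mulr_gt0//= gtr_pMr.
case: ltP => [yltx|xley].
  have sxy : 0 < sin (pi * (x - y)).
    by apply: sin_gt0_pi; rewrite mulr_gt0 ?subr_gt0//= gtr_pMr//; lra.
  by apply: logistic_cvg; exact: mulr_gt0.
have xlty : x < y by rewrite lt_neqAle eq_sym yx.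
have sxy : sin (pi * (x - y)) < 0.
  rewrite -opprB mulrN sinN oppr_lt0.
  by apply: sin_gt0_pi; rewrite mulr_gt0 ?subr_gt0//= gtr_pMr//; lra.
pose c := - (sin (pi * y) * sin (pi * (x - y))).
have c0 : 0 < c by rewrite /c -mulrN mulr_gt0// oppr_gt0.
rewrite (_ : (fun n => _) = (fun n => 1 - (1 + expR (- n%:R * c))^-1)).
  by rewrite -[X in _ --> X](subrr 1); apply: cvgB; [exact: cvg_cst|exact: logistic_cvg].
apply/funext => n; rewrite /bump /c mulrN [in RHS]expRN.
have := expR_gt0 (- n%:R * (sin (pi * y) * sin (pi * (x - y)))).
set E := expR _ => E0; field.
by rewrite !gt_eqF//; lra.
Qed.

(** The integral of g over ]0, x[ is the limit of its integrals against the bumps, by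
dominated convergence. *)
Lemma ae_eq0_of_orthogonal g : L1on 0 1 g ->
  (forall phi, torus_test phi -> int 0 1 (fun x => g x * phi x) = 0) ->
  g =ae cst 0.
Proof.
move=> hg orth; apply: int_eq0_ae => // x x01.
have [x0 x1] := andP x01.
have mg := L1on_measurable hg.
pose h : R -> R := g \_ `[0, x]%classic.
have mh : measurable_fun (`[0, 1] : set R) h.
  apply/measurable_restrict => //; apply: measurable_funS (mg) => //.
have mb n : measurable_fun (`[0, 1] : set R) (bump x n).
  apply: measurable_funTS; apply: continuous_measurable_fun.
  by apply: smooth_on_continuous; case: (torus_test_bump x n).
have lim : {ae leb R, forall y, (`[0, 1]%classic : set R) y ->
    (g y * bump x n y)%:E @[n --> \oo] --> (h y)%:E}.
  move: (ae_neq 0) (ae_neq x) (ae_neq 1); apply: filterS3 => y y0 yx y1.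
  rewrite /= in_itv/= => /andP[y0' y1']; apply: cvg_EFin; first exact: nearW.
  have -> : h y = g y * (if y < x then 1 else 0).
    rewrite /h patchE; case: ifPn => [|].
      rewrite inE/= in_itv/= => /andP[_]; rewrite le_eqVlt (negbTE yx)/= => ->.
      by rewrite mulr1.
    by rewrite notin_setE/= in_itv/= y0'/= => /negP; rewrite -ltNge => /ltW;
      rewrite leNgt => /negbTE ->; rewrite mulr0.
  apply: cvgM; first exact: cvg_cst.
  by apply: bump_cvg => //; rewrite !lt_neqAle eq_sym y0 y0' y1 y1'.
have dom : {ae leb R, forall y n, (`[0, 1]%classic : set R) y ->
    (`|(g y * bump x n y)%:E| <= `|g y|%:E)%E}.
  apply: aeW => y n _; rewrite lee_fin normrM ler_piMr//.
  by have /andP[? ?] := bump_bound x n y; rewrite ger0_norm.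
have [|||||_ _] := @dominated_convergence _ _ _ (leb R) `[0, 1]%classic
  (measurable_itv _) (fun n y => (g y * bump x n y)%:E) (EFin \o h) (fun y => `|g y|%:E).
- move=> n; apply/measurable_EFinP.
  by apply: measurable_funM; [exact: mg|exact: mb].
- exact/measurable_EFinP.
- exact: lim.
- exact: integrable_norm hg.
- exact: dom.
rewrite (_ : [sequence _]_n = cst 0%E); last first.
  apply/funext => n; rewrite -[LHS]fineK.
    by congr EFin; apply: orth; exact: torus_test_bump.
  apply: integrable_fin_num => //; apply: (@L1on_mul_bounded _ _ _ _ (bump x n)) => //.
  by exists 1 => y _; have /andP[? ?] := bump_bound x n y; rewrite ger0_norm.
move=> /(cvg_unique (@ereal_hausdorff R)) /(_ (cvg_cst _)) E.
have sub : (`[0, x]%classic : set R) = `[0, 1] `&` `[0, x].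
  by rewrite setIidr//; apply: subset_itvl; rewrite bnd_simp ltW.
by rewrite sub Rintegral_mkcondr /Rintegral -/h E.
Qed.

End vanishing_integrals.

(** * Weak derivatives have primitives *)

Section weak_derivatives.
Context {R : realType}.
Implicit Types f g F G : R -> R.

(** The integral from a fixed base point is an antiderivative only to the right of that
point, so the base point moves with x and the value at 0 is subtracted. *)
Lemma exists_antiderivative f : continuous f ->
  exists F : R -> R, forall x : R, is_derive x 1 F (f x).
Proof.
move=> cf; have L1 (a b : R) : L1on a b f.
  by apply: within_continuous_L1; exact: continuous_subspaceT.
(* the base point may depend on x: moving it does not change the difference *)
pose P a x := int a x f - int a 0 f.
have PE (a b x : R) : a <= b -> b <= 0 -> b <= x -> P a x = P b x.
  move=> ab b0 bx; rewrite /P (int_split (L1 a x) ab bx) (int_split (L1 a 0) ab b0).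
  by ring.
exists (fun x => P (- (`|x| + 1)) x) => x.
pose b : R := - (`|x| + 2).
have bx : b < x by rewrite /b; have := ler_norm (- x); rewrite normrN; lra.
apply: (@near_eq_is_derive _ _ _ (P b)).
  near=> y.
  have yx : `|x - y| < 1 by near: y; apply: (@cvgr_dist_lt _ _ _ _ _ id) => //.
  have y1 : `|y| <= `|x| + `|x - y|.
    by rewrite -[X in `|X| <= _](subKr x) (le_trans (ler_normB _ _)).
  have y2 := ler_norm (- y); rewrite normrN in y2.
  by have y3 := normr_ge0 y; apply: PE; rewrite /b; lra.
have H := int_derivative bx cf.
by have := is_deriveB H (is_derive_cst (int b 0 f) x 1); rewrite subr0.
Unshelve. all: by end_near. Qed.

Lemma periodic_antiderivative f F : continuous f -> periodic f 1 ->
  int 0 1 f = 0 -> (forall x : R, is_derive x 1 F (f x)) -> periodic F 1.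
Proof.
move=> cf pf f0 dF x; pose D y := F (y + 1) - F y.
have dD (y : R) : is_derive y 1 D 0.
  have d1 : is_derive y 1 (fun y => F (y + 1)) (f (y + 1) * 1).
    apply: (@is_derive1_comp _ F (fun y => y + 1)).
    by apply: is_derive_eq; rewrite addr0.
  by have := is_deriveB d1 (dF y); rewrite mulr1 pf subrr.
have cD : D x = D 0 by exact: is_derive_0_is_cst.
have cF : {within `[0, 1], continuous F}.
  apply: continuous_subspaceT => y; apply: differentiable_continuous.
  by apply/derivable1_diffP; case: (dF y).
have := @int_derive _ 0 1 F f ler01 (continuous_subspaceT cf) cF (fun y _ => dF y).
by rewrite f0; move: cD; rewrite /D add0r; lra.
Qed.

(** Let G be the integral of g from 0. By parts, f - G is orthogonal to the derivatives
of test functions. A test function minus its mean is such a derivative, so f - G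
minus its mean m is orthogonal to all test functions, and f = G + m almost
everywhere. *)
Lemma is_weak_deriv_primitive f g : is_weak_deriv f g ->
  exists F, [/\ primitive F g, F 1 = F 0 & f =ae F].
Proof.
move=> [[pf hf] [pg hg] fg].
have g0 : int 0 1 g = 0.
  have /fg : torus_test (cst 1 : R -> R) by split => //; exact: smooth_on_cst.
  rewrite /torus_integral => /eqP.
  rewrite (@eq_int _ _ _ _ (cst 0)); last by move=> s _; rewrite derive1_cst mulr0.
  rewrite (@eq_int _ _ _ (fun x => g x * cst 1 x) g); last by move=> s _; rewrite mulr1.
  by rewrite Rintegral_cst ?mul0r// eq_sym oppr_eq0 => /eqP.
pose G x := int 0 x g.
have pG : primitive G g by exact: primitive_int.
have cG := primitive_continuous pG.
have hG := within_continuous_L1 cG.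
have hfG : L1on 0 1 (fun x => f x - G x) by exact: L1onB.
pose m := int 0 1 (fun x => f x - G x).
have pGm : primitive (fun x => G x + m) g.
  by split=> // x x01; rewrite /G int_point add0r addrC.
exists (fun x => G x + m); split=> //; first by rewrite /G g0 int_point.
have orth_deriv phi : torus_test phi -> int 0 1 (fun x => (f x - G x) * derive1 phi x) = 0.
  move=> tphi; have [pphi sphi] := tphi.
  have cphi := smooth_on_continuous sphi.
  have cphi' := smooth_on_continuous (smooth_on_derive1 sphi).
  have pphi' : primitive phi (derive1 phi).
    apply: primitive_C1; [exact: continuous_subspaceT|exact: continuous_subspaceT|].
    by move=> x _; exact: smooth_on_is_derive.
  have [hGp /(_ 1)] := primitiveM pG pphi'.
  rewrite ler01 lexx /G int_point g0 !mul0r add0r => /(_ isT).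
  have h1 : L1on 0 1 (fun x => g x * phi x).
    by apply: L1on_mul_continuous => //; exact: continuous_subspaceT.
  have h2 : L1on 0 1 (fun x => G x * derive1 phi x).
    by apply: L1on_mul_continuous => //; exact: continuous_subspaceT.
  have h3 : L1on 0 1 (fun x => f x * derive1 phi x).
    by apply: L1on_mul_continuous => //; exact: continuous_subspaceT.
  rewrite intD// => E; have := fg _ tphi; rewrite /torus_integral => E'.
  rewrite (@eq_int _ _ _ _ (fun x => f x * derive1 phi x - G x * derive1 phi x)).
    by rewrite intB// E' /G; lra.
  by move=> s _; rewrite mulrBl.
have {}orth : (fun x => f x - G x - m) =ae cst 0.
  apply: ae_eq0_of_orthogonal.
    by apply: L1onB => //; exact: (within_continuous_L1 (@within_continuous_cst _ _ _ _)).
  move=> psi [ppsi spsi].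
  have cpsi := smooth_on_continuous spsi.
  pose k := int 0 1 psi.
  have hpsi : L1on 0 1 psi by apply: within_continuous_L1; exact: continuous_subspaceT.
  have hk (c : R) : L1on 0 1 (cst c).
    exact: (within_continuous_L1 (@within_continuous_cst _ _ _ _)).
  have intk (c : R) : int 0 1 (cst c) = c by rewrite int_cst// subr0 mulr1.
  have cpk : continuous (fun x => psi x - k).
    by move=> x; apply: cvgB; [exact: cpsi|exact: cvg_cst].
  have [phi dphi] := exists_antiderivative cpk.
  have tphi : torus_test phi.
    split.
      apply: periodic_antiderivative cpk _ _ dphi.
        by move=> x; rewrite ppsi.
      by rewrite intB// ?intk ?subrr//; exact: hk.
    apply: smooth_on_primitive dphi _.
    apply: smooth_on_setT => n.
    apply: differentiable_uptoD; last exact: differentiable_upto_cst.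
    exact: smooth_on_differentiable_upto.
  have phi'E x : derive1 phi x = psi x - k.
    by rewrite derive1E; exact: derive_val.
  have := orth_deriv _ tphi.
  rewrite (@eq_int _ _ _ _ (fun x => (f x - G x - m) * psi x
    + (m * (psi x - k) - k * (f x - G x - m)))); last first.
    by move=> s _; rewrite phi'E; ring.
  have hu : L1on 0 1 (fun x => f x - G x - m) by apply: L1onB => //; exact: hk.
  have hpk : L1on 0 1 (fun x => psi x - k) by apply: L1onB => //; exact: hk.
  rewrite intD; last 2 first.
  - by apply: L1on_mul_continuous => //; exact: continuous_subspaceT.
  - by apply: L1onB; apply: L1onZ.
  rewrite intB ?intZ//; try exact: L1onZ.
  have -> : int 0 1 (fun s => psi s - k) = 0.
    by have := intB hpsi (hk k); rewrite intk subrr.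
  have -> : int 0 1 (fun s => f s - G s - m) = 0.
    by have := intB hfG (hk m); rewrite intk subrr.
  by rewrite !mulr0 subrr addr0.
apply: filterS orth => x H /H /= /eqP; rewrite subr_eq0 subr_eq => /eqP ->.
by rewrite addrC.
Qed.

End weak_derivatives.

(** * Calculus of weak derivatives *)

Section almost_everywhere_continuous.
Context {R : realType}.
Implicit Types f g F G : R -> R.

Lemma ae_eq_op2 (op : R -> R -> R) f f' g g' : f =ae f' -> g =ae g' ->
  (fun x => op (f x) (g x)) =ae (fun x => op (f' x) (g' x)).
Proof. by apply: filterS2 => x h1 h2 xI; rewrite h1// h2. Qed.

Lemma ae_int f g : measurable_fun (`[0, 1] : set R) f ->
  measurable_fun (`[0, 1] : set R) g -> f =ae g -> int 0 1 f = int 0 1 g.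
Proof.
move=> mf mg fg; rewrite /Rintegral; congr fine; apply: ae_eq_integral => //.
- exact/measurable_EFinP.
- exact/measurable_EFinP.
- by apply: filterS fg => x h /h ->.
Qed.

Lemma ae_int_sub f g (x : R) : 0 <= x <= 1 -> measurable_fun (`[0, 1] : set R) f ->
  measurable_fun (`[0, 1] : set R) g -> f =ae g -> int 0 x f = int 0 x g.
Proof.
move=> /andP[x0 x1] mf mg fg; rewrite /Rintegral; congr fine.
have sub : (`[0, x] : set R) `<=` `[0, 1] by apply: subset_itvl; rewrite bnd_simp.
apply: ae_eq_integral => //.
- by apply/measurable_EFinP; exact: measurable_funS mf.
- by apply/measurable_EFinP; exact: measurable_funS mg.
- by apply: filterS fg => y h /sub /h ->.
Qed.

Lemma L1on_ae f g : measurable_fun (`[0, 1] : set R) f -> L1on 0 1 g -> f =ae g ->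
  L1on 0 1 f.
Proof.
move=> mf hg fg; apply/integrableP; split; first exact/measurable_EFinP.
have mg := L1on_measurable hg.
have /integrableP[_] := hg.
suff -> : (\int[leb R]_(x in `[0%R, 1%R]) `|(EFin \o g) x| =
    \int[leb R]_(x in `[0%R, 1%R]) `|(EFin \o f) x|)%E by [].
apply: ae_eq_integral => //.
- by apply: measurableT_comp => //; exact/measurable_EFinP.
- by apply: measurableT_comp => //; exact/measurable_EFinP.
- by apply: filterS fg => x h /h /= ->.
Qed.

(** The representatives that act as bounded multipliers of L^1. Measurability is required
separately because the Borel sigma-algebra is not complete. *)
Definition ae_continuous f := measurable_fun (`[0, 1] : set R) f /\
  exists2 F : R -> R, {within `[0, 1], continuous F} & f =ae F.

Lemma ae_continuous_L1 f : ae_continuous f -> L1on 0 1 f.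
Proof. by move=> [mf [F /within_continuous_L1 hF fF]]; exact: L1on_ae fF. Qed.

Lemma ae_continuousD f g : ae_continuous f -> ae_continuous g ->
  ae_continuous (fun x => f x + g x).
Proof.
move=> [mf [F cF fF]] [mg [G cG gG]]; split; first exact: measurable_funD.
exists (fun x => F x + G x); first exact: within_continuousD.
exact: (@ae_eq_op2 (fun x y => x + y)).
Qed.

Lemma ae_continuousM f g : ae_continuous f -> ae_continuous g ->
  ae_continuous (fun x => f x * g x).
Proof.
move=> [mf [F cF fF]] [mg [G cG gG]]; split; first exact: measurable_funM.
exists (fun x => F x * G x); first exact: within_continuousM.
exact: (@ae_eq_op2 (fun x y => x * y)).
Qed.

Lemma ae_continuous_cst (k : R) : ae_continuous (cst k).
Proof.
split; first exact: measurable_cst.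
by exists (cst k); [exact: within_continuous_cst|exact: aeW].
Qed.

Lemma L1on_mul_ae_continuous f g : L1on 0 1 f -> ae_continuous g ->
  L1on 0 1 (fun x => f x * g x).
Proof.
move=> hf [mg [G cG gG]].
apply: (@L1on_ae _ (fun x => f x * G x)).
- by apply: measurable_funM => //; exact: L1on_measurable.
- exact: L1on_mul_continuous.
- by apply: filterS gG => x h /h ->.
Qed.

Lemma primitive_ae F f g : primitive F f -> L1on 0 1 g -> f =ae g -> primitive F g.
Proof.
move=> [hf FE] hg fg; split=> // x x01; rewrite FE//; congr (_ + _).
by apply: ae_int_sub => //; exact: L1on_measurable.
Qed.

(** A strict violation of the bound at one point would persist, by continuity,
on an interval of positive length. *)
Lemma ae_ge_everywhere (r : R -> R) (c : R) : {within `[0, 1], continuous r} ->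
  {ae leb R, forall x, (`[0, 1]%classic : set R) x -> c <= r x} ->
  forall x : R, 0 <= x <= 1 -> c <= r x.
Proof.
move=> cr ge x0 /andP[x00 x01]; rewrite leNgt; apply/negP => rc.
have x0I : (`[0, 1]%classic : set R) x0 by rewrite /= in_itv/= x00.
have /subspace_continuousP/(_ x0 x0I) cx := cr.
have : \forall x \near within `[0, 1] (nbhs x0), r x < c.
  exact: (cx _ (lt_nbhsl rc)).
rewrite near_withinE => /nbhs_ballP[e /= e0 He].
pose a : R := Num.max 0 (x0 - e); pose b : R := Num.min 1 (x0 + e).
have ab : a < b by rewrite /a /b gt_max !lt_min; apply/andP; split; apply/andP; split; lra.
case: ge => A [mA A0 sub].
have abA : (`]a, b[ : set R) `<=` A.
  move=> x; rewrite /= in_itv/= gt_max lt_min => /andP[/andP[x0' xl] /andP[x1' xr]].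
  apply: sub => /= h.
  have xI : (`[0, 1]%classic : set R) x by rewrite /= in_itv/= !ltW.
  have := h xI; rewrite leNgt He//.
  by rewrite /ball/= ltr_norml; apply/andP; split; lra.
have mab := @lebesgue_measure_itv R `]a, b[; rewrite /= lte_fin ab -EFinB in mab.
have := le_measure (leb R) (mem_set (measurable_itv `]a, b[)) (mem_set mA) abA.
rewrite [X in (X <= _)%E]mab [X in (_ <= X)%E]A0 lee_fin; lra.
Qed.

End almost_everywhere_continuous.

Section weak_calculus.
Context {R : realType}.
Implicit Types f g F G : R -> R.

Lemma primitive_is_weak_deriv f g F : torus_L1 f -> torus_L1 g -> primitive F g ->
  F 1 = F 0 -> f =ae F -> is_weak_deriv f g.
Proof.
move=> Lf Lg pF F10 fF; split=> // phi [pphi sphi].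
have [[_ hf] [_ hg]] := (Lf, Lg).
have cphi : {within `[0, 1], continuous phi}.
  by apply: continuous_subspaceT; exact: smooth_on_continuous.
have cphi' : {within `[0, 1], continuous (derive1 phi)}.
  by apply: continuous_subspaceT; apply: smooth_on_continuous; exact: smooth_on_derive1.
have pphi' : primitive phi (derive1 phi).
  by apply: primitive_C1 => // x _; exact: smooth_on_is_derive.
have hgp : L1on 0 1 (fun x => g x * phi x) by exact: L1on_mul_continuous.
have hfp : L1on 0 1 (fun x => f x * derive1 phi x) by exact: L1on_mul_continuous.
have hFp : L1on 0 1 (fun x => F x * derive1 phi x).
  by apply: L1on_mul_continuous => //; exact: within_continuous_L1 (primitive_continuous pF).
have [_ /(_ 1)] := primitiveM pF pphi'.
rewrite ler01 lexx F10 => /(_ isT); rewrite intD// => E.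
have phi10 : phi 1 = phi 0 by rewrite -(pphi 0) add0r.
rewrite phi10 in E; rewrite /torus_integral (@ae_int _ _ (fun x => F x * derive1 phi x)).
- lra.
- exact: L1on_measurable.
- exact: L1on_measurable.
- by apply: filterS fF => x h /h ->.
Qed.

Lemma is_weak_deriv_unique f g g' : is_weak_deriv f g -> is_weak_deriv f g' -> g =ae g'.
Proof.
move=> [_ [_ hg] fg] [_ [_ hg'] fg'].
have : (fun x => g x - g' x) =ae cst 0.
  apply: ae_eq0_of_orthogonal; first exact: L1onB.
  move=> phi tphi; have [pphi sphi] := tphi.
  have cphi : {within `[0, 1], continuous phi}.
    by apply: continuous_subspaceT; exact: smooth_on_continuous.
  have := fg phi tphi; have := fg' phi tphi; rewrite /torus_integral.
  rewrite (@eq_int _ _ _ (fun x => (g x - g' x) * phi x) (fun x => g x * phi x - g' x * phi x)).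
    by rewrite intB; [lra|exact: L1on_mul_continuous|exact: L1on_mul_continuous].
  by move=> s _; rewrite mulrBl.
by apply: filterS => x H /H /eqP; rewrite subr_eq0 => /eqP.
Qed.

Lemma is_weak_deriv_ae f f' g : f' =ae f -> torus_L1 f' -> is_weak_deriv f g ->
  is_weak_deriv f' g.
Proof.
move=> ff' Lf' /[dup] -[_ Lg _] /is_weak_deriv_primitive[F [pF F10 fF]].
by apply: primitive_is_weak_deriv pF F10 _ => //; exact: ae_eq_trans ff' fF.
Qed.

Lemma is_weak_deriv_weak_deriv f g : is_weak_deriv f g -> is_weak_deriv f (weak_deriv f).
Proof. by move=> fg; exact: (@xgetPex _ (cst 0) [set g | is_weak_deriv f g] (ex_intro _ g fg)). Qed.

(** The chosen representative of the weak derivative may be replaced by any other under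
an integral. *)
Lemma weak_derivE f g : is_weak_deriv f g -> weak_deriv f =ae g.
Proof. by move=> fg; exact: is_weak_deriv_unique (is_weak_deriv_weak_deriv fg) fg. Qed.

(** This is how exact derivatives disappear from integrals over the torus. *)
Lemma is_weak_deriv_int f g : is_weak_deriv f g -> int 0 1 g = 0.
Proof.
move=> /is_weak_deriv_primitive[F [[_ /(_ 1)] + F10 _]].
by rewrite ler01 lexx F10 => /(_ isT); lra.
Qed.

Lemma is_weak_deriv_ae_continuous f g : is_weak_deriv f g -> ae_continuous f.
Proof.
move=> /[dup] -[[_ /L1on_measurable mf] _ _] /is_weak_deriv_primitive[F [pF _ fF]].
by split=> //; exists F => //; exact: primitive_continuous pF.
Qed.

Lemma is_weak_derivM f f' g g' : is_weak_deriv f f' -> is_weak_deriv g g' ->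
  is_weak_deriv (fun x => f x * g x) (fun x => f' x * g x + f x * g' x).
Proof.
move=> Wf Wg; have cf := is_weak_deriv_ae_continuous Wf.
have cg := is_weak_deriv_ae_continuous Wg.
have [[pf hf] [pf' hf'] _] := Wf; have [[pg hg] [pg' hg'] _] := Wg.
have [F [pF F10 fF]] := is_weak_deriv_primitive Wf.
have [G [pG G10 gG]] := is_weak_deriv_primitive Wg.
have h : L1on 0 1 (fun x => f' x * g x + f x * g' x).
  apply: L1onD; first exact: L1on_mul_ae_continuous.
  by apply: (L1on_eq _ (L1on_mul_ae_continuous hg' cf)) => s _; rewrite mulrC.
apply: (@primitive_is_weak_deriv _ _ (fun x => F x * G x)).
- by split; [move=> x; rewrite pf pg|apply: ae_continuous_L1; exact: ae_continuousM].
- by split=> // x; rewrite pf pg pf' pg'.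
- apply: primitive_ae (primitiveM pF pG) h _.
  by move: fF gG; apply: filterS2 => x h1 h2 xI; rewrite h1// h2.
- by rewrite F10 G10.
- exact: (@ae_eq_op2 _ (fun x y => x * y)).
Qed.

End weak_calculus.

(** * The chain rule *)

Section chain_rule.
Context {R : realType}.
Implicit Types (Phi rho p q : R -> R) (c : R).

Lemma primitive_is_derive (F f : R -> R) : primitive F f -> {within `[0, 1], continuous f} ->
  forall x : R, 0 < x < 1 -> is_derive x 1 F (f x).
Proof.
move=> [hf FE] cf x /andP[x0 x1].
have xI : (`[0, 1]%classic : set R)^° x.
  by rewrite interior_itv_bnd /= in_itv/= x0.
have cfx : {for x, continuous f}.
  move/subspace_continuousP : cf => /(_ x (interior_subset xI)).
  by rewrite within_interior.
have [d e] := continuous_FTC1_closed x1 hf x0 cfx.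
have E : \forall y \near x, F 0 + int 0 y f = F y.
  near=> y.
  have y0 : 0 < y by near: y; exact: lt_nbhsr.
  have y1 : y < 1 by near: y; exact: lt_nbhsl.
  by rewrite (FE y)// !ltW.
apply: near_eq_is_derive E _.
have H : is_derive x 1 (fun y => int 0 y f) (f x) by rewrite -e derive1E; split.
by have := is_deriveD (is_derive_cst (F 0) x 1) H; rewrite add0r.
Unshelve. all: by end_near. Qed.

Lemma ae_continuous_comp Phi rho c : 0 < c -> (forall x, c <= rho x) ->
  (forall s : R, 0 < s -> {for s, continuous Phi}) -> ae_continuous rho ->
  ae_continuous (fun x => Phi (rho x)).
Proof.
move=> c0 rc cPhi [mr [r cr rr]]; split.
  rewrite (_ : (fun x => _) = (fun s => Phi (Num.max s c)) \o rho); last first.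
    by apply/funext => x /=; rewrite max_l.
  apply: measurableT_comp => //; apply: continuous_measurable_fun => s.
  apply: (@continuous_comp _ _ _ (fun s => Num.max s c) Phi).
    rewrite (_ : (fun s => _) = (fun s => (s + c + `|s - c|) / 2)); last first.
      by apply/funext => t; rewrite maxr_absE.
    apply: cvgM; last exact: cvg_cst.
    apply: cvgD; first by apply: cvgD; [exact: cvg_id|exact: cvg_cst].
    by apply: cvg_norm; apply: cvgB; [exact: cvg_id|exact: cvg_cst].
  by apply: cPhi; rewrite lt_max c0 orbT.
have rc' := @ae_ge_everywhere _ r c cr.
exists (fun x => Phi (r x)).
  apply: within_continuous_comp => // x x01; apply: cPhi; apply: lt_le_trans c0 _.
  by apply: rc' x01; apply: filterS rr => y h /h <-.
by apply: filterS rr => y h /h ->.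
Qed.

(** As p is weakly differentiable, rho coincides almost everywhere with a continuously
differentiable function, to which the classical chain rule applies. That function
inherits the lower bound c, so Phi need only be regular on the positive half-line. *)
Lemma is_weak_deriv_comp Phi Phi' rho p q c : 0 < c -> (forall x, c <= rho x) ->
  is_weak_deriv rho p -> is_weak_deriv p q ->
  (forall s : R, 0 < s -> is_derive s 1 Phi (Phi' s)) ->
  (forall s : R, 0 < s -> {for s, continuous Phi'}) ->
  is_weak_deriv (fun x => Phi (rho x)) (fun x => Phi' (rho x) * p x).
Proof.
move=> c0 rc Wp Wq dPhi cPhi'.
have cPhi (s : R) : 0 < s -> {for s, continuous Phi}.
  move=> s0; apply: differentiable_continuous; apply/derivable1_diffP.
  by case: (dPhi s s0).
have arho := is_weak_deriv_ae_continuous Wp.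
have aPhi := ae_continuous_comp c0 rc cPhi arho.
have aPhi' := ae_continuous_comp c0 rc cPhi' arho.
have [[prho _] [pp hp] _] := Wp.
have [r [pr r10 rhor]] := is_weak_deriv_primitive Wp.
have [h [ph _ ph']] := is_weak_deriv_primitive Wq.
have cr := primitive_continuous pr; have ch := primitive_continuous ph.
have {}pr : primitive r h by exact: primitive_ae pr (within_continuous_L1 ch) ph'.
have rc' : forall x : R, 0 <= x <= 1 -> c <= r x.
  by apply: ae_ge_everywhere => //; apply: filterS rhor => y H /H <-.
have r0 (x : R) : 0 <= x <= 1 -> 0 < r x by move=> /rc'; exact: lt_le_trans.
have hPp : L1on 0 1 (fun x => Phi' (rho x) * p x).
  by apply: (L1on_eq _ (L1on_mul_ae_continuous hp aPhi')) => s _; rewrite mulrC.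
have pPhi : primitive (fun x => Phi (r x)) (fun x => Phi' (r x) * h x).
  apply: primitive_C1.
  - by apply: within_continuousM => //; apply: within_continuous_comp => // x /r0 /cPhi'.
  - by apply: within_continuous_comp => // x /r0 /cPhi.
  move=> x /andP[x0 x1]; apply: is_derive1_comp.
    by apply: dPhi; apply: r0; rewrite !ltW.
  by apply: primitive_is_derive => //; rewrite x0.
apply: (@primitive_is_weak_deriv _ _ _ (fun x => Phi (r x))).
- by split; [move=> x; rewrite prho|exact: ae_continuous_L1].
- by split=> // x; rewrite prho pp.
- apply: primitive_ae pPhi hPp _.
  by move: rhor ph'; apply: filterS2 => x h1 h2 xI; rewrite h1// h2.
- by rewrite r10.
- by apply: filterS rhor => y H /H ->.
Qed.

End chain_rule.

(** * The coercivity functional as an integral of squares *)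

Section coercivity_functional.
Context {R : realType}.
Implicit Types (rho p q : R -> R) (c : R).
Variables (mu : R -> R) (delta : R).
Hypothesis mu_smooth : smooth_on [set s : R | 0 < s] mu.

Let mu1 : R -> R := derive1 mu.
Let mu2 : R -> R := derive1 mu1.

Lemma is_derive_mu (s : R) : 0 < s -> is_derive s 1 mu (mu1 s).
Proof. by move=> s0; rewrite /mu1 derive1E; apply/derivableP; exact: (@mu_smooth 0%N s s0). Qed.

Lemma is_derive_mu1 (s : R) : 0 < s -> is_derive s 1 mu1 (mu2 s).
Proof. by move=> s0; rewrite /mu2 derive1E; apply/derivableP; exact: (@mu_smooth 1%N s s0). Qed.

Lemma is_derive_continuous (f : R -> R) (s l : R) : is_derive s 1 f l -> {for s, continuous f}.
Proof. by move=> [d _]; apply: differentiable_continuous; apply/derivable1_diffP. Qed.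

Lemma continuous_mu1 (s : R) : 0 < s -> {for s, continuous mu1}.
Proof. by move=> /is_derive_mu1/is_derive_continuous. Qed.

Lemma continuous_mu2 (s : R) : 0 < s -> {for s, continuous mu2}.
Proof.
move=> s0; have /derivableP := @mu_smooth 2%N s s0.
exact: is_derive_continuous.
Qed.

Lemma is_derive_powR (a s : R) : 0 < s -> is_derive s 1 (fun t => t `^ a) (a * (s `^ a / s)).
Proof.
move=> s0; have := is_derive1_powR a s0.
by rewrite powRB ?(powRr1 (ltW s0))// (gt_eqF s0) implybT.
Qed.

Lemma is_derive_powR_div (a s : R) : 0 < s ->
  is_derive s 1 (fun t => t `^ a / t) ((a - 1) * (s `^ a / s ^+ 2)).
Proof.
move=> s0; have sN0 : s != 0 by rewrite gt_eqF.
have := is_deriveM (is_derive_powR a s0) (is_deriveV sN0 (is_derive_id s 1)).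
suff -> : (a - 1) * (s `^ a / s ^+ 2) =
  s `^ a *: (- s ^- 2 *: 1) + s^-1 *: (a * (s `^ a / s)) by [].
by rewrite /GRing.scale/=; field.
Qed.

Let k := capillarity delta mu.
Let k' (s : R) : R := delta * (s `^ delta / s) * mu1 s ^+ 2 + s `^ delta * (2 * mu1 s * mu2 s).

Lemma is_derive_capillarity (s : R) : 0 < s -> is_derive s 1 k (k' s).
Proof.
move=> s0; have dmu := is_derive_mu1 s0.
have dmu2 := is_deriveM dmu dmu.
have := is_deriveM (is_derive_powR delta s0) dmu2.
suff -> : k' s = s `^ delta *: (mu1 s *: mu2 s + mu1 s *: mu2 s) +
  (mu1 s * mu1 s) *: (delta * (s `^ delta / s)) by [].
by rewrite /k' /GRing.scale/=; ring.
Qed.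

Let Phi (s : R) : R := s `^ delta / s * mu1 s ^+ 3.
Let Phi' (s : R) : R := (delta - 1) * (s `^ delta / s ^+ 2) * mu1 s ^+ 3
  + s `^ delta / s * (3 * mu1 s ^+ 2 * mu2 s).

Let is_derive_Phi (s : R) : 0 < s -> is_derive s 1 Phi (Phi' s).
Proof.
move=> s0; have dmu := is_derive_mu1 s0.
have dmu2 := is_deriveM dmu (is_deriveM dmu dmu).
have := is_deriveM (is_derive_powR_div delta s0) dmu2.
suff -> : Phi' s = (s `^ delta / s) *: (mu1 s *: (mu1 s *: mu2 s + mu1 s *: mu2 s)
  + (mu1 s * mu1 s) *: mu2 s) +
  (mu1 s * (mu1 s * mu1 s)) *: ((delta - 1) * (s `^ delta / s ^+ 2)) by [].
by rewrite /Phi' /GRing.scale/=; ring.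
Qed.

Lemma continuous_k' (s : R) : 0 < s -> {for s, continuous k'}.
Proof.
move=> s0; have c1 := continuous_mu1 s0; have c2 := continuous_mu2 s0.
have cp := is_derive_continuous (is_derive_powR delta s0).
have cpd := is_derive_continuous (is_derive_powR_div delta s0).
apply: cvgD; apply: cvgM => //.
- by apply: cvgM => //; exact: cvg_cst.
- by apply: cvgM.
- by apply: cvgM => //; apply: cvgM => //; exact: cvg_cst.
Qed.

Let continuous_Phi' (s : R) : 0 < s -> {for s, continuous Phi'}.
Proof.
move=> s0; have c1 := continuous_mu1 s0; have c2 := continuous_mu2 s0.
have cp := is_derive_continuous (is_derive_powR delta s0).
have cpd := is_derive_continuous (is_derive_powR_div delta s0).
have cpdd : {for s, continuous (fun s : R => s `^ delta / s ^+ 2)}.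
  apply: cvgM => //; apply: cvgV; first by rewrite expf_neq0// gt_eqF.
  by apply: cvgM; exact: cvg_id.
apply: cvgD; apply: cvgM => //.
- by apply: cvgM => //; exact: cvg_cst.
- by apply: cvgM => //; apply: cvgM.
- by apply: cvgM => //; apply: cvgM => //; [exact: cvg_cst|apply: cvgM].
Qed.

(** The arguments p and q stand for rho' and rho'', and v2 for the second derivative of
mu(rho). *)
Definition coercivity_density (s p q : R) : R :=
  let v2 := mu2 s * p ^+ 2 + mu1 s * q in
  let y := mu1 s * p ^+ 2 / s in
  s `^ delta * mu1 s *
    ((v2 - (1 - delta) / 3 * y) ^+ 2 + (1 - delta) * (2 + delta) / 18 * y ^+ 2).

Lemma coercivity_density_ge0 (s p q : R) : 0 < s -> 0 <= mu1 s -> -2 <= delta <= 1 ->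
  0 <= coercivity_density s p q.
Proof.
move=> s0 mu1s /andP[d1 d2]; rewrite /coercivity_density/= mulr_ge0//.
  by rewrite mulr_ge0// powR_ge0.
rewrite addr_ge0 ?sqr_ge0// mulr_ge0 ?sqr_ge0// divr_ge0// mulr_ge0//; lra.
Qed.

Section formula.
Variables (rho p q : R -> R) (c : R).
Hypotheses (c_gt0 : 0 < c) (rho_ge : forall x, c <= rho x).
Hypotheses (Wrho : is_weak_deriv rho p) (Wp : is_weak_deriv p q) (L2q : torus_L2 q).

Let comp (Psi Psi' : R -> R) : (forall s : R, 0 < s -> is_derive s 1 Psi (Psi' s)) ->
  (forall s : R, 0 < s -> {for s, continuous Psi'}) ->
  is_weak_deriv (fun x => Psi (rho x)) (fun x => Psi' (rho x) * p x).
Proof. exact: (is_weak_deriv_comp c_gt0 rho_ge Wrho Wp). Qed.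

Let acomp (Psi : R -> R) : (forall s : R, 0 < s -> {for s, continuous Psi}) ->
  ae_continuous (fun x => Psi (rho x)).
Proof.
by move=> cPsi; apply: ae_continuous_comp c_gt0 rho_ge cPsi (is_weak_deriv_ae_continuous Wrho).
Qed.

Let v2 x := mu2 (rho x) * p x * p x + mu1 (rho x) * q x.

Let weak_deriv2_mu : weak_deriv (weak_deriv (fun y => mu (rho y))) =ae v2 /\
  torus_L1 (weak_deriv (weak_deriv (fun y => mu (rho y)))).
Proof.
have W1 := comp is_derive_mu continuous_mu1.
have W2 := is_weak_derivM (comp is_derive_mu1 continuous_mu2) Wp.
have [_ L1 _] := is_weak_deriv_weak_deriv W1.
have W3 := is_weak_deriv_ae (weak_derivE W1) L1 W2.
by split; [exact: weak_derivE|case: (is_weak_deriv_weak_deriv W3)].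
Qed.

Let flux x := k' (rho x) * p x * p x + k (rho x) * q x.

Let weak_deriv_flux :
  weak_deriv (fun y => k (rho y) * weak_deriv rho y) =ae flux /\
  torus_L1 (weak_deriv (fun y => k (rho y) * weak_deriv rho y)).
Proof.
have W1 := is_weak_derivM (comp is_derive_capillarity continuous_k') Wp.
have [_ [pd Ld] _] := is_weak_deriv_weak_deriv Wrho.
have W2 : is_weak_deriv (fun y => k (rho y) * weak_deriv rho y) flux.
  apply: is_weak_deriv_ae W1; first by apply: filterS (weak_derivE Wrho) => x h /h ->.
  have [[prho _] _ _] := Wrho; split=> [x|]; first by rewrite prho pd.
  have ak : ae_continuous (fun x => k (rho x)).
    by apply: acomp => s /is_derive_capillarity/is_derive_continuous.
  by apply: (L1on_eq _ (L1on_mul_ae_continuous Ld ak)) => s _; rewrite mulrC.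
by split; [exact: weak_derivE|case: (is_weak_deriv_weak_deriv W2)].
Qed.

Let integrand x := v2 x * (flux x - k' (rho x) / 2 * p x ^+ 2).

Let integrand_L1 : L1on 0 1 integrand.
Proof.
have am1 := acomp continuous_mu1; have am2 := acomp continuous_mu2.
have ak' := acomp continuous_k'.
have ak : ae_continuous (fun x => k (rho x)).
  by apply: acomp => s /is_derive_capillarity/is_derive_continuous.
have ap := is_weak_deriv_ae_continuous Wp.
have [_ [_ hq] _] := Wp; have [_ _ hq2] := L2q.
have a0 := ae_continuousM ap ap.
have a1 := ae_continuousM am1 ak.
have a2 := ae_continuousM a0 (ae_continuousD (ae_continuousM am2 ak)
  (ae_continuousM (ae_continuousM am1 ak') (ae_continuous_cst 2^-1))).
have a3 := ae_continuousM (ae_continuousM a0 a0) (ae_continuousM (ae_continuousM am2 ak') (ae_continuous_cst 2^-1)).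
have h := L1onD (L1onD (L1on_mul_ae_continuous hq2 a1) (L1on_mul_ae_continuous hq a2))
  (ae_continuous_L1 a3).
apply: (L1on_eq _ h) => s _; by rewrite /integrand /v2 /flux/=; field.
Qed.

Let functionalE : coercivity_functional mu k rho = int 0 1 integrand.
Proof.
rewrite /coercivity_functional/= /torus_integral.
have [E1 [_ L1]] := weak_deriv2_mu; have [E2 [_ L2]] := weak_deriv_flux.
have [_ [_ Ld] _] := is_weak_deriv_weak_deriv Wrho.
have k'E (s : R) : 0 < s -> derive1 k s = k' s.
  by move=> /is_derive_capillarity H; rewrite derive1E derive_val.
have rho0 x : 0 < rho x by exact: lt_le_trans (rho_ge x).
apply: ae_int.
- apply: measurable_funM; first exact: L1on_measurable.
  apply: measurable_funB; first exact: L1on_measurable.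
  apply: measurable_funM.
    apply: measurable_funM => //.
    rewrite (_ : (fun x => _) = (fun x => k' (rho x))); first by case: (acomp continuous_k').
    by apply/funext => x; exact: k'E.
  apply: measurable_funX; apply: measurableT_comp => //; exact: L1on_measurable.
- exact: L1on_measurable integrand_L1.
move: E1 E2 (weak_derivE Wrho); apply: filterS3 => x h1 h2 h3 xI.
by rewrite h1// h2// h3// k'E// real_normK ?num_real.
Qed.

(** The density differs from the integrand by a multiple of the derivative of
rho^(delta-1) mu'(rho)^3 (rho')^3, whose integral over the torus vanishes; the
multiple is the one for which what remains is a square plus a term of the sign of
(1 - delta) (2 + delta). *)
Lemma coercivity_functionalE : coercivity_functional mu (capillarity delta mu) rho =
  int 0 1 (fun x => coercivity_density (rho x) (p x) (q x)).
Proof.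
rewrite functionalE.
have WN := is_weak_derivM (comp is_derive_Phi continuous_Phi')
  (is_weak_derivM Wp (is_weak_derivM Wp Wp)).
have [_ [_ LN] _] := WN.
have := intZ (- (4 - delta) / 18) LN; rewrite (is_weak_deriv_int WN) mulr0 => N0.
have := intD integrand_L1 (L1onZ (- (4 - delta) / 18) LN); rewrite N0 addr0 => <-.
apply: eq_int => x _; rewrite /integrand /v2 /flux /coercivity_density/= /k' /k /Phi /Phi'.
rewrite /capillarity -/mu1.
have : rho x != 0 by rewrite gt_eqF// (lt_le_trans c_gt0).
move: (rho x) (p x) (q x) => s a b s0.
move: (mu1 s) (mu2 s) (s `^ delta) => m1 m2 sd.
by field.
Qed.

End formula.

End coercivity_functional.

(** * Changes of variable and periodization *)

Section change_of_variable.
Context {R : realType}.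

(** The map t |-> x with dx/dt = gam(t) / len is inverted. Working with an antiderivative
of gam on the whole line makes both endpoints of [0, 1] interior to the range, so
that the inverse is differentiable there too. *)
Lemma exists_reparametrization (gam : R -> R) (T : R) : 0 < T ->
  continuous gam -> (forall t, 0 < gam t) ->
  exists (len : R) (th : R -> R), [/\ 0 < len, th 0 = 0, th 1 = T &
    forall y : R, 0 <= y <= 1 -> is_derive y 1 th (len / gam (th y))].
Proof.
move=> T0 cg g0; have [G dG] := exists_antiderivative cg.
have cG : continuous G by move=> t; exact: is_derive_continuous (dG t).
have incr (s t : R) : s < t -> G s < G t.
  move=> st; apply: (@gtr0_derive1_incr _ G s t) => //.
  - by move=> x _; rewrite derive1E (@derive_val _ _ _ _ _ _ _ (dG x)).
  - exact: continuous_subspaceT.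
pose len := G T - G 0; have len0 : 0 < len by rewrite subr_gt0 incr.
pose X t := (G t - G 0) / len.
have dX (t : R) : is_derive t 1 X (gam t / len).
  have d1 := is_deriveB (dG t) (is_derive_cst (G 0) t 1).
  have := is_deriveM d1 (is_derive_cst len^-1 t 1).
  suff -> : gam t / len = (G t - G 0) *: (0 : R) + len^-1 *: (gam t - 0) by [].
  by rewrite /GRing.scale/= mulr0 add0r subr0 mulrC.
have incrX (s t : R) : s < t -> X s < X t.
  by move=> st; rewrite ltr_pM2r ?invr_gt0// ltrD2r incr.
have injX : injective X.
  by move=> s t st; case: (ltgtP s t) => // /incrX; rewrite st ltxx.
pose th y := xget 0 [set t | X t = y].
have thK : cancel X th.
  move=> t; apply: injX; exact: (@xgetPex _ 0 [set s | X s = X t] (ex_intro _ t erefl)).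
have X0 : X 0 = 0 by rewrite /X subrr mul0r.
have XT : X T = 1 by rewrite /X divff// gt_eqF.
exists len, th; split=> //; first by rewrite -X0 thK.
  by rewrite -XT thK.
move=> y /andP[y0 y1].
have [t _ Xt] : exists2 t, t \in `[0, T] & X t = y.
  apply: IVT; first exact: ltW.
    by apply: continuous_subspaceT => t; exact: is_derive_continuous (dX t).
  by rewrite X0 XT min_l ?max_r// y0.
rewrite -Xt thK -invf_div.
apply: is_derive_inverse (dX t) _.
- by near=> s; exact: thK.
- by near=> s; exact: is_derive_continuous (dX s).
- by rewrite gt_eqF// divr_gt0.
Unshelve. all: by end_near. Qed.

End change_of_variable.

Section periodization.
Context {R : realType}.
Implicit Types u v : R -> R.

Definition periodize u (x : R) : R := u (x - (Num.floor x)%:~R).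

Lemma periodic_periodize u : periodic (periodize u) 1.
Proof.
move=> x; rewrite /periodize floorDrz ?rpred1// floor1 intrD; congr u; ring.
Qed.

Lemma periodizeE u x : u 1 = u 0 -> 0 <= x <= 1 -> periodize u x = u x.
Proof.
move=> u10 /andP[x0]; rewrite le_eqVlt => /predU1P[->|x1].
  by rewrite /periodize floor1 subrr u10.
rewrite /periodize (_ : Num.floor x = 0) ?subr0//.
by apply/eqP; rewrite floor_eq x0.
Qed.

Lemma torus_L1_periodize u : u 1 = u 0 -> {within `[0, 1], continuous u} ->
  torus_L1 (periodize u).
Proof.
move=> u10 cu; split; first exact: periodic_periodize.
by apply: (L1on_eq _ (within_continuous_L1 cu)) => x x01; rewrite periodizeE.
Qed.

Lemma torus_L2_periodize u : u 1 = u 0 -> {within `[0, 1], continuous u} ->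
  torus_L2 (periodize u).
Proof.
move=> u10 cu; split; first exact: periodic_periodize.
  by apply: L1on_measurable; case: (torus_L1_periodize u10 cu).
have h := within_continuous_L1 (within_continuousM cu cu).
by apply: (L1on_eq _ h) => x x01; rewrite periodizeE// expr2.
Qed.

(** The endpoint conditions make u and v agree with their periodizations on the whole
closed interval [0, 1], so that no null set has to be removed. *)
Lemma is_weak_deriv_periodize u v : u 1 = u 0 -> v 1 = v 0 ->
  {within `[0, 1], continuous v} ->
  (forall x : R, 0 <= x <= 1 -> is_derive x 1 u (v x)) ->
  is_weak_deriv (periodize u) (periodize v).
Proof.
move=> u10 v10 cv du.
have cu : {within `[0, 1], continuous u}.
  by apply: derivable_within_continuous => x; rewrite in_itv/= => /du[].
have Lv := torus_L1_periodize v10 cv.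
apply: (@primitive_is_weak_deriv _ _ _ u) => //.
- exact: torus_L1_periodize.
- apply: primitive_ae (proj2 Lv) _.
    by apply: primitive_C1 cv cu _ => x /andP[x0 x1]; apply: du; rewrite !ltW.
  by apply: aeW => x; rewrite /= in_itv/= => x01; rewrite periodizeE.
- by apply: aeW => x; rewrite /= in_itv/= => x01; rewrite periodizeE.
Qed.

End periodization.

(** * A family of oscillating profiles *)

(** This is delta + 3 a = 1 for a = (1 - delta) / 3, the relation by which the powers of
rho cancel for the oscillating profile. *)
Lemma powR_cube_root {R : realType} (r delta : R) : 0 < r ->
  r `^ delta = r / (r `^ ((1 - delta) / 3)) ^+ 3.
Proof.
move=> r0; set a := (1 - delta) / 3.
have r1 : r `^ delta * (r `^ a) ^+ 3 = r.
  rewrite -powR_mulrn ?powR_ge0// -powRrM -powRD; last by rewrite (gt_eqF r0) implybT.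
  by rewrite (_ : delta + a * 3 = 1) ?(powRr1 (ltW r0))// /a; field.
by apply: (canRL (mulfK _)) => //; rewrite expf_neq0// gt_eqF// powR_gt0.
Qed.

(** The cancellation behind the choice of the change of variable, with r = rho,
e = rho^b, m = mu'(rho), m2 = mu''(rho), p = rho' and q = rho''; here len / (m r / e)
is the derivative of the angle, whose sine is s and cosine c. In v2 - b y the terms
in m2 and those in c^2 cancel. *)
Lemma oscillating_density_algebra {F : fieldType} (r e m m2 s c kp b M len : F) :
  r != 0 -> e != 0 -> m != 0 ->
  let p := len * M * (c * (e * m^-1)) in
  let q := len * M * e * ((b * M * c ^+ 2 - s) / m - M * c ^+ 2 * r * m2 / m ^+ 2)
    * (len / (m * r / e)) in
  let v2 := m2 * p ^+ 2 + m * q in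
  let y := m * p ^+ 2 / r in
  r / e ^+ 3 * m * ((v2 - b * y) ^+ 2 + kp * y ^+ 2) =
  len ^+ 3 * (M ^+ 2 * s ^+ 2 + kp * M ^+ 4 * c ^+ 4) * (len / (m * r / e)).
Proof.
move=> r0 e0 m0 p q v2 y.
have yE : y = len ^+ 2 * M ^+ 2 * c ^+ 2 * e ^+ 2 / (m * r).
  by rewrite /y /p; field; rewrite r0 m0.
have -> : v2 - b * y = - (len ^+ 2 * M * s * e ^+ 2 / (m * r)).
  by rewrite yE /v2 /p /q; field; rewrite r0 e0 m0.
by rewrite yE; field; rewrite r0 e0 m0.
Qed.

Lemma is_derive_trig_antiderivative {R : realType} (x z t : R) :
  is_derive t 1 (fun t => x * (t / 2 - sin t * cos t / 2) +
    z * (3 * t / 8 + 3 / 8 * (sin t * cos t) + cos t ^+ 3 * sin t / 4))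
    (x * sin t ^+ 2 + z * cos t ^+ 4).
Proof.
apply: is_derive_eq; rewrite /GRing.scale/=.
have := cos2Dsin2 t; move: (sin t) (cos t) => s c sc.
apply/eqP; rewrite -subr_eq0; apply/eqP.
transitivity ((1 - (c ^+ 2 + s ^+ 2)) * (x / 2 + z * (3 / 8 + 3 / 4 * c ^+ 2))).
  by field.
by rewrite sc subrr mul0r.
Qed.

Section oscillating_profile.
Context {R : realType}.
Variables (mu : R -> R) (delta M : R).
Hypothesis mu_smooth : smooth_on [set s : R | 0 < s] mu.
Hypothesis mu'_gt0 : forall s : R, 0 < s -> 0 < derive1 mu s.

Let mu1 : R -> R := derive1 mu.
Let mu2 : R -> R := derive1 mu1.
Let a : R := (1 - delta) / 3.
Let kap : R := (1 - delta) * (2 + delta) / 18.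
Let rad (t : R) : R := expR (M * sin t).
Let E (t : R) : R := rad t `^ a.
(** The ratio dx / dt up to a constant, mu'(rho) rho^(1-a). *)
Let gam (t : R) : R := mu1 (rad t) * rad t / E t.

Let rad_gt0 t : 0 < rad t. Proof. exact: expR_gt0. Qed.
Let E_gt0 t : 0 < E t. Proof. exact: powR_gt0. Qed.
Let mu1_gt0 t : 0 < mu1 (rad t). Proof. exact: mu'_gt0. Qed.
Let gam_gt0 t : 0 < gam t.
Proof. by rewrite divr_gt0// mulr_gt0. Qed.

Let d_rad (t : R) : is_derive t 1 rad (rad t * (M * cos t)).
Proof.
have d : is_derive t 1 (fun t => M * sin t) (M * cos t).
  have := is_deriveM (is_derive_cst M t 1) (is_derive_sin t).
  by rewrite scaler0 addr0.
exact: (@is_derive1_comp _ expR (fun t => M * sin t) t _ _ (is_derive_expR _) d).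
Qed.

Let d_E (t : R) : is_derive t 1 E (a * E t * (M * cos t)).
Proof.
have := @is_derive1_comp _ (fun s => s `^ a) rad t _ _ (is_derive_powR a (rad_gt0 t)) (d_rad t).
suff -> : a * E t * (M * cos t) = a * (rad t `^ a / rad t) * (rad t * (M * cos t)) by [].
by rewrite -/(E t); field; rewrite gt_eqF.
Qed.

Let d_mu1 (t : R) :
  is_derive t 1 (fun t => mu1 (rad t)) (mu2 (rad t) * (rad t * (M * cos t))).
Proof.
exact: (@is_derive1_comp _ mu1 rad t _ _ (is_derive_mu1 mu_smooth (rad_gt0 t)) (d_rad t)).
Qed.

Let c_sin : continuous (@sin R). Proof. exact: continuous_sin. Qed.
Let c_cos : continuous (@cos R). Proof. exact: continuous_cos. Qed.
Let c_rad : continuous rad.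
Proof. by move=> t; exact: is_derive_continuous (d_rad t). Qed.
Let c_E : continuous E.
Proof. by move=> t; exact: is_derive_continuous (d_E t). Qed.
Let c_mu1 : continuous (fun t => mu1 (rad t)).
Proof. by move=> t; exact: is_derive_continuous (d_mu1 t). Qed.
Let c_mu2 : continuous (fun t => mu2 (rad t)).
Proof.
move=> t; apply: (@continuous_comp _ _ _ rad mu2); first exact: c_rad.
exact: continuous_mu2.
Qed.
Let c_gam : continuous gam.
Proof.
move=> t; apply: cvgM; first by apply: cvgM; [exact: c_mu1|exact: c_rad].
by apply: cvgV; [rewrite gt_eqF|exact: c_E].
Qed.

Section profile.
Variables (len : R) (th : R -> R).
Hypotheses (th0 : th 0 = 0) (th1 : th 1 = pi *+ 2).
Hypothesis d_th : forall y : R, 0 <= y <= 1 -> is_derive y 1 th (len / gam (th y)).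

Let c_th : {within `[0, 1], continuous th}.
Proof.
by apply: derivable_within_continuous => x; rewrite in_itv/= => /d_th[].
Qed.

(** The derivatives rho' and rho'' in x, as functions of the angle t: H is
(d rho / dt) (dt / dx) and K is H' (dt / dx). *)
Let H (t : R) : R := len * M * (cos t * (E t * (mu1 (rad t))^-1)).
Let H' (t : R) : R := len * M * E t *
  ((a * M * cos t ^+ 2 - sin t) / mu1 (rad t)
   - M * cos t ^+ 2 * rad t * mu2 (rad t) / mu1 (rad t) ^+ 2).
Let K (t : R) : R := H' t * (len / gam t).

Let d_H (t : R) : is_derive t 1 H (H' t).
Proof.
have m0 : mu1 (rad t) != 0 by rewrite gt_eqF.
have := is_deriveM (is_derive_cst (len * M) t 1) (is_deriveM (is_derive_cos t)
  (is_deriveM (d_E t) (@is_deriveV _ (fun t => mu1 (rad t)) t _ 1 m0 (d_mu1 t)))).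
match goal with |- is_derive _ _ _ ?d -> _ => suff -> : H' t = d by [] end.
by rewrite !fctE /H' /GRing.scale/=; field.
Qed.

Let c_K : continuous K.
Proof.
move=> t; apply: cvgM; last first.
  apply: cvgM; first exact: cvg_cst.
  by apply: cvgV; [rewrite gt_eqF|exact: c_gam].
have cc : {for t, continuous (fun t : R => cos t ^+ 2)} by apply: cvgM; exact: c_cos.
have cV : {for t, continuous (fun t : R => (mu1 (rad t))^-1)}.
  by apply: cvgV; [rewrite gt_eqF|exact: c_mu1].
apply: cvgM; first by apply: cvgM; [exact: cvg_cst|exact: c_E].
apply: cvgB.
  apply: cvgM => //; apply: cvgB; last exact: c_sin.
  by apply: cvgM => //; exact: cvg_cst.
apply: cvgM.
  apply: cvgM; last exact: c_mu2.
  apply: cvgM; last exact: c_rad.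
  by apply: cvgM => //; exact: cvg_cst.
apply: cvgV; first by rewrite expf_neq0// gt_eqF.
by apply: cvgM; exact: c_mu1.
Qed.

Let d_profile (y : R) : 0 <= y <= 1 -> is_derive y 1 (rad \o th) (H (th y)).
Proof.
move=> /d_th dth; have := @is_derive1_comp _ rad th y _ _ (d_rad (th y)) dth.
suff -> : H (th y) = rad (th y) * (M * cos (th y)) * (len / gam (th y)) by [].
rewrite /H /gam; field.
by rewrite !gt_eqF.
Qed.

Let d_profile' (y : R) : 0 <= y <= 1 -> is_derive y 1 (H \o th) (K (th y)).
Proof. by move=> /d_th dth; exact: (@is_derive1_comp _ H th y _ _ (d_H (th y)) dth). Qed.

Let cos2pi0 : cos (th 1) = cos (th 0). Proof. by rewrite th0 th1 cos2pi cos0. Qed.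
Let sin2pi0 : sin (th 1) = sin (th 0). Proof. by rewrite th0 th1 sin2pi sin0. Qed.
Let rad10 : rad (th 1) = rad (th 0). Proof. by rewrite /rad sin2pi0. Qed.
Let H10 : H (th 1) = H (th 0).
Proof. by rewrite /H /E cos2pi0 rad10. Qed.
Let K10 : K (th 1) = K (th 0).
Proof. by rewrite /K /H' /gam /E cos2pi0 sin2pi0 rad10. Qed.

Definition profile : R -> R := periodize (rad \o th).

Let cH : {within `[0, 1], continuous (H \o th)}.
Proof.
apply: within_continuous_comp c_th _ => y _.
exact: is_derive_continuous (d_H (th y)).
Qed.

Let cKth : {within `[0, 1], continuous (K \o th)}.
Proof. by apply: within_continuous_comp c_th _ => y _; exact: c_K. Qed.

Let W1 : is_weak_deriv profile (periodize (H \o th)).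
Proof. exact: is_weak_deriv_periodize. Qed.

Let W2 : is_weak_deriv (periodize (H \o th)) (periodize (K \o th)).
Proof. exact: is_weak_deriv_periodize. Qed.

Let L2K : torus_L2 (periodize (K \o th)).
Proof. exact: torus_L2_periodize. Qed.

Lemma torus_H2_profile : torus_H2 profile.
Proof.
have crad : {within `[0, 1], continuous (rad \o th)}.
  by apply: within_continuous_comp c_th _ => y _; exact: c_rad.
split; first exact: torus_L2_periodize.
exists (periodize (H \o th)), (periodize (K \o th)).
split; [exact: (torus_L2_periodize H10 cH)|exact: L2K|exact: W1|exact: W2].
Qed.

Lemma profile_ge (x : R) : expR (- `|M|) <= profile x.
Proof.
rewrite /profile /periodize/= /rad ler_expR.
set t := th _; rewrite -lerN2 opprK.
apply: le_trans (ler_norm _) _; rewrite normrN normrM; apply: ler_piMr; first exact: normr_ge0.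
by rewrite ler_norml sin_geN1 sin_le1.
Qed.

Let density_profile (t : R) : coercivity_density mu delta (rad t) (H t) (K t) =
  len ^+ 3 * (M ^+ 2 * sin t ^+ 2 + kap * M ^+ 4 * cos t ^+ 4) * (len / gam t).
Proof.
have r0 := rad_gt0 t; have e0 := E_gt0 t; have m0 := mu1_gt0 t.
have pow : rad t `^ delta = rad t / E t ^+ 3 by exact: powR_cube_root.
rewrite /coercivity_density/= pow.
apply: (@oscillating_density_algebra R (rad t) (E t) (mu1 (rad t))); exact: lt0r_neq0.
Qed.

Let F (t : R) : R := M ^+ 2 * (t / 2 - sin t * cos t / 2) +
  kap * M ^+ 4 * (3 * t / 8 + 3 / 8 * (sin t * cos t) + cos t ^+ 3 * sin t / 4).

(** The density is dt / dx times a function of the angle alone, so an explicit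
antiderivative F in the angle evaluates the integral over one turn. *)
Lemma coercivity_functional_profile :
  coercivity_functional mu (capillarity delta mu) profile =
  len ^+ 3 * (pi * M ^+ 2 * (1 + 3 / 4 * (kap * M ^+ 2))).
Proof.
have c0 := expR_gt0 (- `|M|).
rewrite (coercivity_functionalE delta mu_smooth c0 profile_ge W1 W2 L2K).
pose D (t : R) : R :=
  len ^+ 3 * (M ^+ 2 * sin t ^+ 2 + kap * M ^+ 4 * cos t ^+ 4) * (len / gam t).
have -> : int 0 1 (fun x => coercivity_density mu delta (profile x)
    (periodize (H \o th) x) (periodize (K \o th) x)) = int 0 1 (fun y => D (th y)).
  apply: eq_int => y y01; rewrite /D -density_profile.
  rewrite (periodizeE H10 y01) (periodizeE K10 y01).
  by rewrite /profile (periodizeE _ y01); [reflexivity|exact: rad10].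
have dF (y : R) : 0 <= y <= 1 ->
    is_derive y 1 (fun y => len ^+ 3 * F (th y)) (D (th y)).
  move=> y01.
  have d1 := is_derive_trig_antiderivative (M ^+ 2) (kap * M ^+ 4) (th y).
  have d2 := @is_derive1_comp _ F th y _ _ d1 (d_th y01).
  suff -> : D (th y) = len ^+ 3 *: ((M ^+ 2 * sin (th y) ^+ 2
      + kap * M ^+ 4 * cos (th y) ^+ 4) * (len / gam (th y))) + F (th y) *: (0 : R).
    exact: (is_deriveM (is_derive_cst (len ^+ 3) y 1) d2).
  by rewrite /D scaler0 addr0; exact: esym (mulrA _ _ _).
have cD : {within `[0, 1], continuous (fun y => D (th y))}.
  apply: within_continuous_comp c_th _ => y _.
  have cs : {for th y, continuous (fun t : R => sin t ^+ 2)} by apply: cvgM; exact: c_sin.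
  have cc : {for th y, continuous (fun t : R => cos t ^+ 4)}.
    do 3 (apply: cvgM; first exact: c_cos).
    exact: c_cos.
  apply: cvgM.
    apply: cvgM; first exact: cvg_cst.
    by apply: cvgD; (apply: cvgM; first exact: cvg_cst); [exact: cs|exact: cc].
  apply: cvgM; first exact: cvg_cst.
  by apply: cvgV; [exact: lt0r_neq0|exact: c_gam].
have cF : {within `[0, 1], continuous (fun y => len ^+ 3 * F (th y))}.
  by apply: derivable_within_continuous => y; rewrite in_itv/= => /dF[].
have dF' (y : R) : 0 < y < 1 -> is_derive y 1 (fun y => len ^+ 3 * F (th y)) (D (th y)).
  by move=> /andP[y0 y1]; apply: dF; rewrite (ltW y0) (ltW y1).
rewrite (int_derive ler01 cD cF dF') -mulrBr; congr (_ * _).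
rewrite /F th1 th0 sin2pi cos2pi sin0 cos0.
move: (pi : R) kap => q z; rewrite -mulr_natr; field; exact: isT.
Qed.

End profile.

Lemma exists_profile : exists (rho : R -> R) (len : R),
  [/\ torus_H2 rho, (exists2 c : R, 0 < c & forall x, c <= rho x), 0 < len &
  coercivity_functional mu (capillarity delta mu) rho =
  len ^+ 3 * (pi * M ^+ 2 * (1 + 3 / 4 * (kap * M ^+ 2)))].
Proof.
have T0 : 0 < pi *+ 2 :> R by rewrite pmulrn_lgt0// pi_gt0.
have [len [th [len0 th0 th1 dth]]] := exists_reparametrization T0 c_gam gam_gt0.
exists (profile th), len; split.
- exact: torus_H2_profile th0 th1 dth.
- by exists (expR (- `|M|)); [exact: expR_gt0|move=> x; exact: profile_ge].
- exact: len0.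
- exact: coercivity_functional_profile th0 th1 dth.
Qed.

End oscillating_profile.

(** * The theorem *)

Unset Implicit Arguments.
Set Strict Implicit.
Set Printing Implicit Defensive.

Theorem theorem1p4 (R : realType) (mu : R -> R) (delta : R)
    (mu_ge0 : forall s : R, 0 <= s -> 0 <= mu s)
    (mu_incr : forall s t : R, 0 <= s -> s < t -> mu s < mu t)
    (mu0 : mu 0 = 0)
    (mu_smooth : smooth_on [set s : R | 0 < s] mu)
    (mu'_gt0 : forall s : R, 0 < s -> 0 < derive1 mu s) :
  strong_coercivity mu (capillarity delta mu) <-> -2 <= delta <= 1.
Proof.
split=> [SC | delta_range].
  have kap_ge0 : 0 <= (1 - delta) * (2 + delta) / 18.
    rewrite leNgt; apply/negP; set kap := _ / 18 => kap_lt0.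
    (* with this amplitude the quartic term is -3/2 of the quadratic one *)
    pose M := Num.sqrt (2 / - kap).
    have M2 : M ^+ 2 = 2 / - kap by rewrite sqr_sqrtr// divr_ge0// oppr_ge0 ltW.
    have [rho [len [H2 lb len_gt0 J]]] := exists_profile delta M mu_smooth mu'_gt0.
    have := SC rho H2 lb; rewrite J -/kap M2 leNgt => /negP; apply.
    rewrite pmulr_rlt0 ?exprn_gt0// pmulr_rlt0; last first.
      by rewrite mulr_gt0 ?pi_gt0// divr_gt0// oppr_gt0.
    have -> : kap * (2 / - kap) = -2 by field; rewrite lt_eqF.
    by lra.
  by move: kap_ge0; rewrite pmulr_lge0 ?invr_gt0// => h; apply/andP; split; nra.
move=> rho [L2rho [p [q [L2p L2q Wrho Wp]]]] [c c_gt0 rho_ge].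
rewrite (coercivity_functionalE delta mu_smooth c_gt0 rho_ge Wrho Wp L2q).
apply: Rintegral_ge0 => x _.
have rho_gt0 : 0 < rho x by exact: lt_le_trans (rho_ge x).
by apply: coercivity_density_ge0 => //; exact/ltW/mu'_gt0.
Qed.
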